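(* Let $F\in\mathbb{P}(\mathbb{Z}^+)$. The following four conditions are equivalent. (I) $F\in\mathcal{A}$. (II) The convolution operator $L(F)$, $L(F)H=F*H$, is a Ritt operator on $L^1(\mathbb{Z})$. (III) For every complex Banach space $X$ and every power-bounded $T\in\mathcal{L}(X)$, the operator $\Psi(F;T)$ is a Ritt operator. (IV) $\widehat{F}(\xi)\in\mathbb{D}\cup\{1\}$ for all $\xi\in[-\pi,\pi]$, and $\sup_{t\ge1}t\|(\delta_0-F)*e^{-t(\delta_0-F)}\|_{L^1(\mathbb{Z})}<\infty$. Moreover, if $F\in\mathcal{A}$, then there exists $\theta\in(0,\pi/2)$ such that $\phi_F(w)\in\mathbb{D}\cup\{1\}$ and $1-\phi_F(w)\in\overline{\Lambda}_\theta$ for all $w\in\overline{\mathbb{D}}$. Finally, if $F\in\mathcal{A}\setminus\{\delta_0\}$, then $\sum_{k\ge0}kF(k)=+\infty$, and hence $\mathrm{supp}(F)$ is infinite.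
   Context: $L^1(\mathbb{Z})$ is the Banach algebra of summable $F:\mathbb{Z}\to\mathbb{C}$ with norm $\sum_k|F(k)|$, convolution product $*$, unit $\delta_0$ (point mass at $0$); $F^{(n)}$ is the $n$-th convolution power and $e^{A}=\sum_{k\ge0}A^k/k!$ in this algebra. $\mathbb{P}(\mathbb{Z}^+)$ is the set of $F\in L^1(\mathbb{Z})$ with $F\ge0$, $\sum F=1$, $F(k)=0$ for $k<0$. $\mathcal{A}=\{F\in\mathbb{P}(\mathbb{Z}^+):\sup_{n\in\mathbb{N}}n\|F^{(n)}-F^{(n+1)}\|_{L^1(\mathbb{Z})}<\infty\}$. An operator $T$ is power-bounded if $\sup_n\|T^n\|<\infty$; it is a Ritt operator if power-bounded and $\sup_n n\|T^n-T^{n+1}\|<\infty$. $\Psi(F;T)=\sum_{k\ge0}F(k)T^k$ ($T^0=I$). $\widehat{F}(\xi)=\sum_kF(k)e^{-ik\xi}$, $\phi_F(w)=\sum_{k\ge0}F(k)w^k$ for $w\in\overline{\mathbb{D}}=\{|w|\le1\}$, $\mathbb{D}=\{|w|<1\}$, and $\overline{\Lambda}_\theta=\{0\}\cup\{z\in\mathbb{C}:|\mathrm{Arg}\,z|\le\theta\}$. *)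

(* Defs.v *)
From Stdlib Require Import Reals ZArith.
From Coquelicot Require Import Coquelicot.
Open Scope R_scope.

(** Limit of the partial sums of a series in a complete normed module
    (the value of sum_{k>=0} a k when the series converges). *)
Definition series_lim {K : AbsRing} {V : CompleteNormedModule K} (a : nat -> V) : V :=
  lim (filtermap (sum_n a) eventually).

(** Elements of L^1(Z) are represented as functions Z -> C. *)
Definition neg_idx (n : nat) : Z := (- Z.of_nat (S n))%Z.

Definition summable (u : Z -> C) : Prop :=
  ex_series (fun n : nat => Cmod (u (Z.of_nat n)) + Cmod (u (neg_idx n))).

(** sum over Z (meaningful for summable u) *)
Definition zsum (u : Z -> C) : C :=
  Cplus (@series_lim C_AbsRing C_CompleteNormedModule (fun n => u (Z.of_nat n)))
        (@series_lim C_AbsRing C_CompleteNormedModule (fun n => u (neg_idx n))).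

Definition l1norm (u : Z -> C) : R :=
  Series (fun n : nat => Cmod (u (Z.of_nat n)) + Cmod (u (neg_idx n))).

Definition conv (F H : Z -> C) : Z -> C :=
  fun n => zsum (fun k => Cmult (F k) (H (n - k)%Z)).

Definition delta0 : Z -> C := fun n => if Z.eq_dec n 0 then RtoC 1 else RtoC 0.

Definition lsub (F H : Z -> C) : Z -> C := fun n => Cminus (F n) (H n).
Definition lscal (c : C) (F : Z -> C) : Z -> C := fun n => Cmult c (F n).

Fixpoint convpow (F : Z -> C) (n : nat) : Z -> C :=
  match n with
  | O => delta0
  | S m => conv F (convpow F m)
  end.

(** exponential in the Banach algebra L^1(Z): e^A = sum_k A^(k)/k!
    (the L^1-convergent series, evaluated pointwise) *)
Definition lexp (A : Z -> C) : Z -> C :=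
  fun n => @series_lim C_AbsRing C_CompleteNormedModule
             (fun k => Cmult (RtoC (/ INR (fact k))) (convpow A k n)).

Definition PZplus (F : Z -> C) : Prop :=
  (forall k, 0 <= Re (F k) /\ Im (F k) = 0) /\
  summable F /\ zsum F = RtoC 1 /\
  (forall k, (k < 0)%Z -> F k = RtoC 0).

Definition classA (F : Z -> C) : Prop :=
  PZplus F /\
  exists M : R, forall n : nat,
    INR n * l1norm (lsub (convpow F n) (convpow F (S n))) <= M.

(** Power-bounded and Ritt operators T on a normed space, given by the
    domain D, norm nrm and subtraction sub (operator norms unfolded). *)
Definition power_bounded {V : Type} (D : V -> Prop) (nrm : V -> R) (T : V -> V) : Prop :=
  exists M : R, forall n : nat, forall x, D x -> nrm (Nat.iter n T x) <= M * nrm x.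

Definition ritt {V : Type} (D : V -> Prop) (nrm : V -> R) (sub : V -> V -> V)
  (T : V -> V) : Prop :=
  power_bounded D nrm T /\
  exists M : R, forall n : nat, forall x, D x ->
    INR n * nrm (sub (Nat.iter n T x) (Nat.iter (S n) T x)) <= M * nrm x.

Definition clinear {X : CompleteNormedModule C_AbsRing} (T : X -> X) : Prop :=
  (forall x y : X, T (plus x y) = plus (T x) (T y)) /\
  (forall (c : C) (x : X), T (scal c x) = scal c (T x)).

Definition Psi (F : Z -> C) {X : CompleteNormedModule C_AbsRing} (T : X -> X) : X -> X :=
  fun x => series_lim (fun k : nat => scal (F (Z.of_nat k)) (Nat.iter k T x)).

Definition Fhat (F : Z -> C) (xi : R) : C :=
  zsum (fun k => Cmult (F k) (cos (IZR k * xi), - sin (IZR k * xi))).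

Definition phiF (F : Z -> C) (w : C) : C :=
  @series_lim C_AbsRing C_CompleteNormedModule
    (fun k : nat => Cmult (F (Z.of_nat k)) (@pow_n C_Ring w k)).

Definition in_sector (theta : R) (z : C) : Prop :=
  z = RtoC 0 \/
  exists a : R, - PI < a <= PI /\ Rabs a <= theta /\
    z = Cmult (RtoC (Cmod z)) (cos a, sin a).

Definition in_D_or_1 (z : C) : Prop := Cmod z < 1 \/ z = RtoC 1.

(* Main.v *)
(** Write A = delta_0 - F.  Since F is real and lives on the nonnegative integers, everything
    takes place in the real algebra l^1(N), whose identities can be checked on generating
    functions over (-1, 1).

    (I) => (II), (III): G |-> Psi(G; T) is a bounded homomorphism on l^1(N).  (III) => (I): for
    the shift on bounded sequences, Psi(G; T) applied to the sign sequence of G has value |G|_1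
    at 0.  (I) => (IV): e^{-tA} is the Poisson average of the powers of F.

    (IV) => (I): let a_n = |F^n A|_1.  The condition on the Fourier transform makes some F^k and
    F^(k+1) share an atom s of mass >= c.  Then F^(jk+j) dominates
    c^j / (j+1) delta_{js} * (1 + F + ... + F^j), which A nearly annihilates, so
    lim a_n <= 2 / (j+1) for every j, that is, a_n -> 0.  Next, F - e^{-A} = - A^2 g and
    |A^2 e^{-sA}|_1 = O(1/s^2); telescoping F^N - e^{-NA} and using a_n -> 0 for the first terms
    gives d_N := |F^N - e^{-NA}|_1 -> 0.  Finally a_{2N} <= |A e^{-NA}|_1 + d_N a_N
    <= C / N + d_N a_N, which keeps n a_n bounded.

    Sector: z = phi_F(w) satisfies n |z|^n |1 - z| <= M, and n close to 1 / (2 (1 - |z|)) gives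
    |1 - z| <= K (1 - |z|) <= K Re (1 - z).  If F had a finite mean mu, then
    1 - phi_F(e^{i x}) = - i mu x + o(x), which leaves the sector unless mu = 0. *)

Require Import Defs.
From Stdlib Require Import Reals ZArith Lra Lia Classical ClassicalEpsilon.
From Stdlib Require Import FunctionalExtensionality PropExtensionality ProofIrrelevance.
From Coquelicot Require Import Coquelicot.
Open Scope R_scope.

(** The two halves of (IV) remove different obstacles. At a unimodular z <> 1 the quantity |1 - z|
    e^{-t Re (1 - z)} decays exponentially, so pointwise the semigroup bound does not exclude
    periodicity, such as the value -1 of the transform of an F living on the odd integers; the
    Fourier condition does. It yields a_n -> 0 without any rate, and the rate 1/n comes from the
    semigroup.

    The two meet in the comparison of F^N with e^{-NA}. There the O(1/s^2) estimate says nothing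
    about the first few s, whose contribution is fixed; only the power F^m left in front of these
    terms makes them small, through a_m -> 0. It is then enough that d_N falls below a fixed
    constant, because the doubling recursion for n a_n absorbs it.

    The operator conditions share one tool: all the operators involved are sums of a_k u_k along an
    orbit u, and the product formula is proved once, for arbitrary bounded orbits in a complex
    Banach space. *)

(** * Series of nonnegative reals *)

Lemma lim_sum_is_series (a : nat -> R) (l : R) : is_lim_seq (sum_n a) l -> is_series a l.
Proof. exact (fun H => H). Qed.

Lemma sum_n_nonneg (a : nat -> R) (N : nat) :
  (forall n, 0 <= a n) -> 0 <= sum_n a N.
Proof.
  intros Ha; induction N as [|N IH].
  - rewrite sum_O; apply Ha.
  - rewrite sum_Sn; apply Rplus_le_le_0_compat; [exact IH | apply Ha].
Qed.

Lemma sum_n_mono (a b : nat -> R) (N : nat) :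
  (forall n, a n <= b n) -> sum_n a N <= sum_n b N.
Proof.
  intros Hab; induction N as [|N IH].
  - rewrite !sum_O; apply Hab.
  - rewrite !sum_Sn; apply Rplus_le_compat; [exact IH | apply Hab].
Qed.

Lemma sum_n_scal_R (c : R) (a : nat -> R) (N : nat) :
  sum_n (fun k => c * a k) N = c * sum_n a N.
Proof. exact (sum_n_mult_l (K := R_Ring) c a N). Qed.

Lemma sum_n_le_Series (a : nat -> R) (N : nat) :
  (forall n, 0 <= a n) -> ex_series a -> sum_n a N <= Series a.
Proof.
  intros Ha [l Hl].
  rewrite (is_series_unique _ _ Hl).
  refine (is_lim_seq_incr_compare (sum_n a) l Hl _ N).
  intros n; rewrite sum_Sn; unfold plus; simpl; generalize (Ha (S n)); lra.
Qed.

Lemma ex_series_bounded (a : nat -> R) (B : R) :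
  (forall n, 0 <= a n) -> (forall N, sum_n a N <= B) ->
  ex_series a /\ Series a <= B.
Proof.
  intros Ha HB.
  assert (Hex : ex_series a).
  { destruct (ex_finite_lim_seq_incr (sum_n a) B) as [l Hl].
    - intros n; rewrite sum_Sn; unfold plus; simpl; generalize (Ha (S n)); lra.
    - exact HB.
    - exists l; exact Hl. }
  split; [exact Hex|].
  destruct Hex as [l Hl].
  rewrite (is_series_unique _ _ Hl).
  exact (is_lim_seq_le (sum_n a) (fun _ => B) l B HB Hl (is_lim_seq_const B)).
Qed.

Lemma term_le_Series (a : nat -> R) (n : nat) :
  (forall n, 0 <= a n) -> ex_series a -> a n <= Series a.
Proof.
  intros Ha Hex.
  apply Rle_trans with (2 := sum_n_le_Series a n Ha Hex).
  destruct n as [|n]; [rewrite sum_O; apply Rle_refl|].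
  rewrite sum_Sn; unfold plus; simpl.
  generalize (sum_n_nonneg a n Ha); lra.
Qed.

Lemma Series_nonneg (a : nat -> R) :
  (forall n, 0 <= a n) -> ex_series a -> 0 <= Series a.
Proof.
  intros Ha Hex; apply Rle_trans with (1 := Ha 0%nat); now apply term_le_Series.
Qed.

(** Exchanges a finite sum with a series. Used on each partial sum in [n], it takes the place of
    Tonelli's theorem for the double series below. *)
Lemma is_series_sum_n (v : nat -> nat -> R) (M : nat) :
  (forall n, ex_series (fun k => v k n)) ->
  is_series (fun k => sum_n (v k) M) (sum_n (fun n => Series (fun k => v k n)) M).
Proof.
  intros Hv; induction M as [|M IH].
  - rewrite sum_O; apply is_series_ext with (fun k => v k 0%nat).
    + intros k; now rewrite sum_O.
    + apply Series_correct, Hv.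
  - rewrite sum_Sn.
    apply is_series_ext with (fun k => plus (sum_n (v k) M) (v k (S M))).
    + intros k; now rewrite sum_Sn.
    + apply @is_series_plus; [exact IH | apply Series_correct, Hv].
Qed.

(** * The real convolution algebra of summable sequences *)

(** Summability is bundled with the sequence, so that the product is a total operation and [ring]
    works on Leibniz equality. *)
Record L1 : Type := mkL1 {
  coef :> nat -> R;
  coef_summable : ex_series (fun n => Rabs (coef n)) }.

Definition nm (a : L1) : R := Series (fun n => Rabs (a n)).
Definition tr (a : L1) (x : R) : R := PSeries a x.

Lemma nm_ge0 (a : L1) : 0 <= nm a.
Proof. apply Series_nonneg; [intros; apply Rabs_pos | apply coef_summable]. Qed.

Lemma coef_le_nm (a : L1) (n : nat) : Rabs (a n) <= nm a.
Proof.
  exact (term_le_Series (fun n => Rabs (a n)) n (fun _ => Rabs_pos _) (coef_summable a)).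
Qed.

Lemma L1_radius (a : L1) : Rbar_le 1 (CV_radius a).
Proof.
  apply (proj1 (CV_radius_bounded a)).
  exists (nm a); intros n; rewrite pow1, Rmult_1_r; apply coef_le_nm.
Qed.

Lemma L1_inside (a : L1) (x : R) : Rabs x < 1 -> Rbar_lt (Rabs x) (CV_radius a).
Proof. intros Hx; exact (Rbar_lt_le_trans (Rabs x) 1 _ Hx (L1_radius a)). Qed.

Lemma L1_eq (a b : L1) : (forall n, a n = b n) -> a = b.
Proof.
  destruct a as [a Ha], b as [b Hb]; simpl; intros H.
  assert (E : a = b) by (apply functional_extensionality; exact H).
  subst b; f_equal; apply proof_irrelevance.
Qed.

(** A power series with positive radius is determined by its values near 0. The interval is open
    because the radius of convergence may be exactly 1. *)
Lemma L1_ext (a b : L1) : (forall x, Rabs x < 1 -> tr a x = tr b x) -> a = b.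
Proof.
  intros H; apply L1_eq; intros n.
  apply PSeries_ext_recip.
  - rewrite <- Rabs_R0; apply L1_inside; rewrite Rabs_R0; lra.
  - rewrite <- Rabs_R0; apply L1_inside; rewrite Rabs_R0; lra.
  - exists (mkposreal 1 Rlt_0_1); intros x Hx; apply H.
    unfold ball in Hx; simpl in Hx; unfold AbsRing_ball, abs, minus, plus, opp in Hx.
    simpl in Hx; replace x with (x + - 0) by ring; exact Hx.
Qed.

Definition seq_one (n : nat) : R := match n with O => 1 | S _ => 0 end.

Lemma sum_n_seq_one (N : nat) : sum_n (fun n => Rabs (seq_one n)) N = 1.
Proof.
  induction N as [|N IH]; [rewrite sum_O; apply Rabs_R1|].
  rewrite sum_Sn, IH; simpl; rewrite Rabs_R0; unfold plus; simpl; ring.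
Qed.

Lemma seq_one_summable : ex_series (fun n => Rabs (seq_one n)).
Proof.
  apply (ex_series_bounded _ 1); [intros; apply Rabs_pos|].
  intros N; rewrite sum_n_seq_one; lra.
Qed.

Lemma add_summable (a b : L1) : ex_series (fun n => Rabs (a n + b n)).
Proof.
  apply @ex_series_le with (fun n => Rabs (a n) + Rabs (b n)).
  - intros n; unfold norm; simpl; unfold abs; simpl; rewrite Rabs_Rabsolu; apply Rabs_triang.
  - apply @ex_series_plus; apply coef_summable.
Qed.

Lemma scal_summable (c : R) (a : L1) : ex_series (fun n => Rabs (c * a n)).
Proof.
  apply ex_series_ext with (fun n => Rabs c * Rabs (a n)).
  - intros n; symmetry; apply Rabs_mult.
  - apply @ex_series_scal with (V := R_NormedModule); apply coef_summable.
Qed.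

Lemma Rabs_PS_mult (a b : nat -> R) (n : nat) :
  Rabs (PS_mult a b n) <= PS_mult (fun k => Rabs (a k)) (fun k => Rabs (b k)) n.
Proof.
  unfold PS_mult.
  apply Rle_trans with (1 := Rsum_abs _ n), Req_le, sum_eq.
  intros i _; apply Rabs_mult.
Qed.

Lemma abs_mult_is_series (a b : L1) :
  is_series (PS_mult (fun k => Rabs (a k)) (fun k => Rabs (b k))) (nm a * nm b).
Proof.
  assert (Habs : forall c : L1, ex_series (fun n => Rabs (Rabs (c n)))).
  { intros c; apply ex_series_ext with (fun n => Rabs (c n)).
    - intros n; now rewrite Rabs_Rabsolu.
    - apply coef_summable. }
  apply is_series_mult; try apply Habs; apply Series_correct, coef_summable.
Qed.

Lemma mul_summable (a b : L1) : ex_series (fun n => Rabs (PS_mult a b n)).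
Proof.
  apply @ex_series_le with (PS_mult (fun k => Rabs (a k)) (fun k => Rabs (b k))).
  - intros n; unfold norm; simpl; unfold abs; simpl; rewrite Rabs_Rabsolu; apply Rabs_PS_mult.
  - eexists; apply abs_mult_is_series.
Qed.

Definition one1 : L1 := mkL1 seq_one seq_one_summable.
Definition add (a b : L1) : L1 := mkL1 (fun n => a n + b n) (add_summable a b).
Definition scl (c : R) (a : L1) : L1 := mkL1 (fun n => c * a n) (scal_summable c a).
Definition mul (a b : L1) : L1 := mkL1 (PS_mult a b) (mul_summable a b).
Definition opp1 (a : L1) : L1 := scl (-1) a.
Definition sub (a b : L1) : L1 := add a (opp1 b).
Definition zero1 : L1 := scl 0 one1.

Lemma tr_one (x : R) : tr one1 x = 1.
Proof.
  unfold tr, PSeries; apply is_series_unique, lim_sum_is_series.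
  apply (is_lim_seq_ext (fun _ => 1)); [|apply is_lim_seq_const].
  intros N; induction N as [|N IH]; [rewrite sum_O; simpl; ring|].
  rewrite sum_Sn, <- IH; unfold plus; simpl; ring.
Qed.

Lemma tr_add (a b : L1) (x : R) : Rabs x < 1 -> tr (add a b) x = tr a x + tr b x.
Proof.
  intros Hx; apply (PSeries_plus a b x); apply CV_radius_inside, L1_inside, Hx.
Qed.

Lemma tr_scl (c : R) (a : L1) (x : R) : tr (scl c a) x = c * tr a x.
Proof. apply (PSeries_scal c a x). Qed.

Lemma tr_mul (a b : L1) (x : R) : Rabs x < 1 -> tr (mul a b) x = tr a x * tr b x.
Proof. intros Hx; apply (PSeries_mult a b x); apply L1_inside, Hx. Qed.

Lemma tr_opp (a : L1) (x : R) : tr (opp1 a) x = - tr a x.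
Proof. unfold opp1; rewrite tr_scl; ring. Qed.

Lemma tr_sub (a b : L1) (x : R) : Rabs x < 1 -> tr (sub a b) x = tr a x - tr b x.
Proof. intros Hx; unfold sub; rewrite tr_add, tr_opp by assumption; ring. Qed.

Lemma tr_zero (x : R) : tr zero1 x = 0.
Proof. unfold zero1; rewrite tr_scl; ring. Qed.

(* The transform is injective and multiplicative, so algebraic identities reduce to [ring] on R. *)
Ltac by_tr :=
  apply L1_ext; let x := fresh "x" in let Hx := fresh "Hx" in intros x Hx;
  repeat first [ rewrite tr_add by exact Hx | rewrite tr_sub by exact Hx
               | rewrite tr_mul by exact Hx | rewrite tr_opp | rewrite tr_scl
               | rewrite tr_one | rewrite tr_zero ];
  try ring.

Lemma L1_ring : ring_theory zero1 one1 add mul sub opp1 (@eq L1).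
Proof. constructor; intros; by_tr. Qed.

Add Ring L1_ring : L1_ring.

Lemma nm_add (a b : L1) : nm (add a b) <= nm a + nm b.
Proof.
  unfold nm; rewrite <- Series_plus by apply coef_summable.
  apply Series_le.
  - intros n; split; [apply Rabs_pos | apply Rabs_triang].
  - apply @ex_series_plus; apply coef_summable.
Qed.

Lemma nm_scl (c : R) (a : L1) : nm (scl c a) = Rabs c * nm a.
Proof.
  unfold nm; rewrite <- Series_scal_l; apply Series_ext; intros n; apply Rabs_mult.
Qed.

Lemma nm_opp (a : L1) : nm (opp1 a) = nm a.
Proof. unfold opp1; rewrite nm_scl, (Rabs_left (-1)) by lra; ring. Qed.

Lemma nm_sub (a b : L1) : nm (sub a b) <= nm a + nm b.
Proof. rewrite <- (nm_opp b); apply nm_add. Qed.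

Lemma nm_mul (a b : L1) : nm (mul a b) <= nm a * nm b.
Proof.
  rewrite <- (is_series_unique _ _ (abs_mult_is_series a b)).
  apply Series_le.
  - intros n; split; [apply Rabs_pos | apply Rabs_PS_mult].
  - eexists; apply abs_mult_is_series.
Qed.

Lemma nm_one : nm one1 = 1.
Proof.
  apply is_series_unique, lim_sum_is_series.
  apply (is_lim_seq_ext (fun _ => 1)); [|apply is_lim_seq_const].
  intros N; symmetry; apply sum_n_seq_one.
Qed.

Lemma nm_mul_le (a b : L1) (x y : R) : nm a <= x -> nm b <= y -> nm (mul a b) <= x * y.
Proof.
  intros Ha Hb; apply Rle_trans with (1 := nm_mul a b).
  apply Rmult_le_compat; auto using nm_ge0.
Qed.

Fixpoint pw (a : L1) (n : nat) : L1 :=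
  match n with O => one1 | S m => mul a (pw a m) end.

Lemma pw_add (a : L1) (m n : nat) : pw a (m + n) = mul (pw a m) (pw a n).
Proof. induction m as [|m IH]; simpl; [|rewrite IH]; ring. Qed.

Lemma nm_pw (a : L1) (n : nat) : nm (pw a n) <= nm a ^ n.
Proof.
  induction n as [|n IH]; simpl; [rewrite nm_one; lra|].
  apply nm_mul_le; [lra | exact IH].
Qed.

Lemma tr_pw (a : L1) (n : nat) (x : R) : Rabs x < 1 -> tr (pw a n) x = tr a x ^ n.
Proof.
  intros Hx; induction n as [|n IH]; simpl; [apply tr_one|].
  now rewrite tr_mul, IH.
Qed.

Lemma tr_le_nm (a : L1) (x : R) : Rabs x < 1 -> Rabs (tr a x) <= nm a.
Proof.
  intros Hx.
  assert (Hle : forall n, 0 <= Rabs (a n * x ^ n) <= Rabs (a n)).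
  { intros n; split; [apply Rabs_pos|].
    rewrite Rabs_mult, <- (Rmult_1_r (Rabs (a n))) at 1.
    rewrite Rmult_1_r. rewrite <- (Rmult_1_r (Rabs (a n))) at 2.
    apply Rmult_le_compat_l; [apply Rabs_pos|].
    rewrite <- RPow_abs, <- (pow1 n).
    apply pow_incr; split; [apply Rabs_pos | lra]. }
  assert (Hex : ex_series (fun n => Rabs (a n * x ^ n))).
  { apply @ex_series_le with (fun n => Rabs (a n)); [|apply coef_summable].
    intros n; unfold norm; simpl; unfold abs; simpl; rewrite Rabs_Rabsolu; apply Hle. }
  apply Rle_trans with (1 := Series_Rabs _ Hex).
  apply Series_le; [exact Hle | apply coef_summable].
Qed.

(** * Norm-convergent series in the algebra *)

Section LSum.

Variable u : nat -> L1.
Hypothesis Hu : ex_series (fun k => nm (u k)).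

Lemma lsum_pointwise (n : nat) : ex_series (fun k => Rabs (u k n)).
Proof.
  apply @ex_series_le with (2 := Hu).
  intros k; unfold norm; simpl; unfold abs; simpl; rewrite Rabs_Rabsolu; apply coef_le_nm.
Qed.

(** Each partial sum over the coefficients is moved inside the series over [k], where it is at most
    [nm (u k)]; this gives summability and the bound at once. *)
Lemma lsum_bound :
  ex_series (fun n => Rabs (Series (fun k => u k n))) /\
  Series (fun n => Rabs (Series (fun k => u k n))) <= Series (fun k => nm (u k)).
Proof.
  apply ex_series_bounded; [intros; apply Rabs_pos|].
  intros M.
  apply Rle_trans with (sum_n (fun n => Series (fun k => Rabs (u k n))) M).
  - apply sum_n_mono; intros n; apply Series_Rabs, lsum_pointwise.
  - rewrite <- (is_series_unique _ _
      (is_series_sum_n (fun k n => Rabs (u k n)) M lsum_pointwise)).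
    apply Series_le; [|exact Hu].
    intros k; split; [apply sum_n_nonneg; intros; apply Rabs_pos|].
    apply sum_n_le_Series; [intros; apply Rabs_pos | apply coef_summable].
Qed.

Definition lsum : L1 := mkL1 (fun n => Series (fun k => u k n)) (proj1 lsum_bound).

Lemma nm_lsum : nm lsum <= Series (fun k => nm (u k)).
Proof. apply lsum_bound. Qed.

End LSum.

Fixpoint psum (u : nat -> L1) (K : nat) : L1 :=
  match K with O => u 0%nat | S K' => add (psum u K') (u K) end.

Lemma psum_coef (u : nat -> L1) (K n : nat) : psum u K n = sum_n (fun k => u k n) K.
Proof.
  induction K as [|K IH]; [now rewrite sum_O|].
  rewrite sum_Sn, <- IH; reflexivity.
Qed.

Lemma tr_psum (u : nat -> L1) (K : nat) (x : R) :
  Rabs x < 1 -> tr (psum u K) x = sum_n (fun k => tr (u k) x) K.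
Proof.
  intros Hx; induction K as [|K IH]; [now rewrite sum_O|].
  rewrite sum_Sn, <- IH; simpl; now rewrite tr_add.
Qed.

Lemma Series_tail (a : nat -> R) (K : nat) :
  ex_series a -> Series (fun k => a (S K + k)%nat) = Series a - sum_n a K.
Proof.
  intros Ha.
  rewrite (Series_incr_n a (S K)) by (try apply Ha; lia).
  simpl pred; rewrite sum_n_Reals; ring.
Qed.

Lemma sum_n_to_Series (a : nat -> R) : ex_series a -> is_lim_seq (sum_n a) (Series a).
Proof. intros H; exact (Series_correct a H). Qed.

(** The remainder is itself an [lsum], of the family shifted by [S K], so [nm_lsum] bounds it. Hence
    the coefficientwise sum is also the limit in norm. *)
Lemma lsum_tail (u : nat -> L1) (Hu : ex_series (fun k => nm (u k))) (K : nat) :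
  nm (sub (lsum u Hu) (psum u K)) <= Series (fun k => nm (u k)) - sum_n (fun k => nm (u k)) K.
Proof.
  assert (Hu' : ex_series (fun k => nm (u (S K + k)%nat)))
    by exact (proj1 (ex_series_incr_n (fun k => nm (u k)) (S K)) Hu).
  rewrite <- (Series_tail (fun k => nm (u k))) by exact Hu.
  replace (sub (lsum u Hu) (psum u K)) with (lsum (fun k => u (S K + k)%nat) Hu');
    [apply nm_lsum|].
  apply L1_eq; intros n.
  assert (E := Series_tail (fun k => u k n) K (ex_series_Rabs _ (lsum_pointwise u Hu n))).
  change (Series (fun k => u (S K + k)%nat n) = Series (fun k => u k n) + -1 * psum u K n).
  rewrite psum_coef, E; ring.
Qed.

(** Evaluation at [x] is linear of norm at most 1, so it commutes with norm-convergent series. This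
    makes identities between exponentials checkable pointwise. *)
Lemma tr_lsum (u : nat -> L1) (Hu : ex_series (fun k => nm (u k))) (x : R) :
  Rabs x < 1 -> is_series (fun k => tr (u k) x) (tr (lsum u Hu) x).
Proof.
  intros Hx; apply lim_sum_is_series.
  apply (is_lim_seq_ext (fun K => tr (lsum u Hu) x - tr (sub (lsum u Hu) (psum u K)) x)).
  { intros K; rewrite tr_sub, tr_psum by exact Hx; simpl; ring. }
  replace (Finite (tr (lsum u Hu) x)) with (Finite (tr (lsum u Hu) x - 0))
    by (f_equal; ring).
  apply is_lim_seq_minus'; [apply is_lim_seq_const|].
  apply is_lim_seq_abs_0.
  apply is_lim_seq_le_le with (u := fun _ => 0)
    (w := fun K => Series (fun k => nm (u k)) - sum_n (fun k => nm (u k)) K).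
  - intros K; split; [apply Rabs_pos|].
    apply Rle_trans with (1 := tr_le_nm _ _ Hx), lsum_tail.
  - apply is_lim_seq_const.
  - replace (Finite 0) with (Finite (Series (fun k => nm (u k)) - Series (fun k => nm (u k))))
      by (f_equal; ring).
    apply is_lim_seq_minus'; [apply is_lim_seq_const | now apply sum_n_to_Series].
Qed.

(** * Exponentials and the discrete Ritt condition *)

Lemma is_series_eq (a : nat -> R) (l1 l2 : R) : is_series a l1 -> is_series a l2 -> l1 = l2.
Proof. intros H1 H2; rewrite <- (is_series_unique _ _ H1); now apply is_series_unique. Qed.

Lemma exp_is_series (y : R) : is_series (fun k => / INR (fact k) * y ^ k) (exp y).
Proof.
  apply is_series_ext with (2 := is_exp_Reals y).
  intros k; rewrite pow_n_pow; unfold scal; simpl; unfold mult; simpl; ring.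
Qed.

Lemma inv_fact_pos (k : nat) : 0 < / INR (fact k).
Proof. apply Rinv_0_lt_compat, INR_fact_lt_0. Qed.

Lemma nm_exp_term (b : L1) (k : nat) :
  nm (scl (/ INR (fact k)) (pw b k)) <= / INR (fact k) * nm b ^ k.
Proof.
  rewrite nm_scl, Rabs_pos_eq by (generalize (inv_fact_pos k); lra).
  apply Rmult_le_compat_l; [generalize (inv_fact_pos k); lra | apply nm_pw].
Qed.

Lemma ex_series_nm_le (u : nat -> L1) (b : nat -> R) :
  (forall k, nm (u k) <= b k) -> ex_series b -> ex_series (fun k => nm (u k)).
Proof.
  intros H; apply @ex_series_le; intros k; unfold norm; simpl; unfold abs; simpl.
  rewrite Rabs_pos_eq by apply nm_ge0; apply H.
Qed.

Lemma nm_lsum_le (u : nat -> L1) (Hu : ex_series (fun k => nm (u k))) (b : nat -> R) (l : R) :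
  (forall k, nm (u k) <= b k) -> is_series b l -> nm (lsum u Hu) <= l.
Proof.
  intros H Hb; apply Rle_trans with (1 := nm_lsum u Hu).
  rewrite <- (is_series_unique _ _ Hb).
  apply Series_le; [intros k; split; [apply nm_ge0 | apply H] | now exists l].
Qed.

Lemma ex1_summable (b : L1) : ex_series (fun k => nm (scl (/ INR (fact k)) (pw b k))).
Proof.
  apply ex_series_nm_le with (1 := nm_exp_term b); eexists; apply exp_is_series.
Qed.

Definition ex1 (b : L1) : L1 := lsum _ (ex1_summable b).

Lemma nm_ex1 (b : L1) : nm (ex1 b) <= exp (nm b).
Proof. exact (nm_lsum_le _ _ _ _ (nm_exp_term b) (exp_is_series _)). Qed.

Lemma tr_ex1 (b : L1) (x : R) : Rabs x < 1 -> tr (ex1 b) x = exp (tr b x).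
Proof.
  intros Hx.
  refine (is_series_eq _ _ _ (tr_lsum _ (ex1_summable b) x Hx) _).
  apply is_series_ext with (2 := exp_is_series (tr b x)).
  intros k; now rewrite tr_scl, tr_pw.
Qed.

Section Contraction.

Variable f : L1.
Hypothesis f_le1 : nm f <= 1.

Let A : L1 := sub one1 f.
Let a (n : nat) : R := nm (mul (pw f n) A).
Let heat (t : R) : L1 := ex1 (scl (- t) A).

Lemma nm_pw_le1 (n : nat) : nm (pw f n) <= 1.
Proof.
  apply Rle_trans with (1 := nm_pw f n); rewrite <- (pow1 n).
  apply pow_incr; split; [apply nm_ge0 | exact f_le1].
Qed.

Lemma nm_one_sub : nm A <= 2.
Proof. apply Rle_trans with (1 := nm_sub one1 f); rewrite nm_one; lra. Qed.

Lemma gap_decr (n : nat) : a (S n) <= a n.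
Proof.
  unfold a; simpl.
  replace (mul (mul f (pw f n)) A) with (mul f (mul (pw f n) A)) by ring.
  rewrite <- (Rmult_1_l (nm (mul (pw f n) A))); apply nm_mul_le; lra.
Qed.

Lemma gap_le2 (n : nat) : a n <= 2.
Proof.
  replace 2 with (1 * 2) by ring; apply nm_mul_le; [apply nm_pw_le1 | apply nm_one_sub].
Qed.

Lemma gap_antitone (m n : nat) : (m <= n)%nat -> a n <= a m.
Proof.
  induction 1 as [|n _ IH]; [apply Rle_refl|].
  now apply Rle_trans with (1 := gap_decr n).
Qed.

Lemma tr_heat (t x : R) : Rabs x < 1 -> tr (heat t) x = exp (- t * (1 - tr f x)).
Proof.
  intros Hx; unfold heat, A; rewrite tr_ex1, tr_scl, tr_sub, tr_one by exact Hx.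
  reflexivity.
Qed.

Lemma heat_poisson (t : R) : heat t = scl (exp (- t)) (ex1 (scl t f)).
Proof.
  apply L1_ext; intros x Hx.
  rewrite tr_heat, tr_scl, tr_ex1, tr_scl, <- exp_plus by exact Hx; f_equal; ring.
Qed.

(** Bounding the exponential of -tA directly would only give e^{2t}; in the form [heat_poisson] the
    factor e^{-t} cancels the bound e^t. *)
Lemma heat_le1 (t : R) : 0 <= t -> nm (heat t) <= 1.
Proof.
  intros Ht; rewrite heat_poisson, nm_scl, Rabs_pos_eq by (left; apply exp_pos).
  apply Rle_trans with (exp (- t) * exp t).
  - apply Rmult_le_compat_l; [left; apply exp_pos|].
    apply Rle_trans with (1 := nm_ex1 _).
    rewrite nm_scl, (Rabs_pos_eq t) by exact Ht.
    assert (t * nm f <= t * 1) by (apply Rmult_le_compat_l; lra).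
    destruct (Req_dec (t * nm f) t) as [->|Hne]; [apply Rle_refl|].
    left; apply exp_increasing; lra.
  - rewrite <- exp_plus, Rplus_opp_l, exp_0; apply Rle_refl.
Qed.

Lemma heat_add (s t : R) : heat (s + t) = mul (heat s) (heat t).
Proof.
  apply L1_ext; intros x Hx.
  rewrite tr_mul, !tr_heat, <- exp_plus by exact Hx; f_equal; ring.
Qed.

Lemma heat_0 : heat 0 = one1.
Proof.
  apply L1_ext; intros x Hx.
  rewrite tr_heat, tr_one, <- exp_0 by exact Hx; f_equal; ring.
Qed.

Lemma exp_shift_is_series (t : R) :
  is_series (fun k => / INR (fact (S k)) * t ^ S k) (exp t - 1).
Proof.
  assert (H := is_series_incr_1 (fun k => / INR (fact k) * t ^ k) (exp t - 1)).
  apply H.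
  match goal with |- is_series _ ?l => replace l with (exp t) end; [apply exp_is_series|].
  unfold plus; simpl; field.
Qed.

(** A e^{-tA} = e^{-t} sum_k (t^k / k!) F^k A. Inserting a_k <= (2M + 2) / (k + 1) turns t^k / k!
    into t^{k+1} / (k + 1)! up to the factor 1/t, and the sum is again an exponential series,
    without its first term. *)
Lemma ritt_heat (M : R) :
  (forall n, INR n * a n <= M) ->
  forall t, 0 < t -> t * nm (mul A (heat t)) <= 2 * M + 2.
Proof.
  intros HM t Ht.
  set (c k := / INR (fact k) * t ^ k).
  assert (Hc : forall k, 0 <= c k).
  { intros k; apply Rmult_le_pos; [left; apply inv_fact_pos | apply pow_le; lra]. }
  set (u k := scl (c k) (mul (pw f k) A)).
  assert (Hnu : forall k, nm (u k) <= (2 * M + 2) / t * (/ INR (fact (S k)) * t ^ S k)).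
  { intros k; unfold u; rewrite nm_scl, Rabs_pos_eq by apply Hc.
    (* For k >= 1 one has k + 1 <= 2k, so 2M suffices; at k = 0 the hypothesis only says 0 <= M, and
       a_0 <= 2 takes over. *)
    assert (Ha : INR (S k) * a k <= 2 * M + 2).
    { generalize (HM k) (gap_le2 k) (nm_ge0 (mul (pw f k) A)); fold (a k).
      destruct k as [|k]; [simpl; lra|].
      rewrite !S_INR; generalize (pos_INR k); intros; nra. }
    assert (HS : 0 < INR (S k)) by (apply lt_0_INR; lia).
    apply Rle_trans with (c k * ((2 * M + 2) / INR (S k))).
    - apply Rmult_le_compat_l; [apply Hc|].
      fold (a k); apply Rmult_le_reg_l with (1 := HS).
      replace (INR (S k) * ((2 * M + 2) / INR (S k))) with (2 * M + 2) by (field; lra).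
      exact Ha.
    - right; unfold c; rewrite fact_simpl, mult_INR; simpl pow.
      field; repeat split; try lra; apply INR_fact_neq_0. }
  assert (Hsum := is_series_scal_l ((2 * M + 2) / t) _ _ (exp_shift_is_series t)).
  assert (Hu : ex_series (fun k => nm (u k)))
    by (apply ex_series_nm_le with (1 := Hnu); eexists; apply Hsum).
  assert (E : mul A (heat t) = scl (exp (- t)) (lsum u Hu)).
  { apply L1_ext; intros x Hx.
    rewrite tr_mul, tr_heat, tr_scl by exact Hx.
    rewrite <- (is_series_unique _ _ (tr_lsum u Hu x Hx)).
    replace (Series (fun k => tr (u k) x)) with (exp (t * tr f x) * tr A x).
    - replace (- t * (1 - tr f x)) with (- t + t * tr f x) by ring.
      rewrite exp_plus; ring.
    - rewrite <- (is_series_unique _ _ (exp_is_series (t * tr f x))), <- Series_scal_r.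
      apply Series_ext; intros k; unfold u, c.
      rewrite tr_scl, tr_mul, tr_pw, Rpow_mult_distr by exact Hx; ring. }
  rewrite E, nm_scl, Rabs_pos_eq by (left; apply exp_pos).
  assert (Hl : nm (lsum u Hu) <= (2 * M + 2) / t * (exp t - 1))
    by exact (nm_lsum_le u Hu _ _ Hnu Hsum).
  assert (HM0 : 0 <= M) by (generalize (HM 0%nat); simpl; lra).
  apply Rle_trans with (t * (exp (- t) * ((2 * M + 2) / t * exp t))).
  - apply Rmult_le_compat_l; [lra|]; apply Rmult_le_compat_l; [left; apply exp_pos|].
    apply Rle_trans with (1 := Hl), Rmult_le_compat_l; [|lra].
    apply Rmult_le_pos; [lra | left; now apply Rinv_0_lt_compat].
  - right.
    replace (t * (exp (- t) * ((2 * M + 2) / t * exp t)))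
      with ((exp (- t) * exp t) * (2 * M + 2)) by (field; lra).
    rewrite <- exp_plus, Rplus_opp_l, exp_0; ring.
Qed.

(** A crude majorant, from 1 / (k + 2)! <= 1 / k! and |A| <= 2: it has to make the series for [g]
    converge, and only the finiteness of |g| enters later. *)
Lemma second_order_term (k : nat) :
  nm (scl ((-1) ^ k * / INR (fact (S (S k)))) (pw A k)) <= / INR (fact k) * 2 ^ k.
Proof.
  rewrite nm_scl, Rabs_mult, pow_1_abs, Rmult_1_l.
  rewrite Rabs_pos_eq by (left; apply inv_fact_pos).
  apply Rmult_le_compat; [left; apply inv_fact_pos | apply nm_ge0 | |].
  - apply Rinv_le_contravar; [apply INR_fact_lt_0|].
    apply le_INR, fact_le; lia.
  - apply Rle_trans with (1 := nm_pw A k), pow_incr; split; [apply nm_ge0 | apply nm_one_sub].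
Qed.

Lemma second_order_summable :
  ex_series (fun k => nm (scl ((-1) ^ k * / INR (fact (S (S k)))) (pw A k))).
Proof.
  apply ex_series_nm_le with (1 := second_order_term); eexists; apply exp_is_series.
Qed.

(* [g = (e^{-A} - 1 + A) / A^2], as a power series in [A]. *)
Let g : L1 := lsum _ second_order_summable.

(** With y = [tr A x] this reads 1 - y - e^{-y} = - (e^{-y} - 1 + y). Removing the first two terms
    of the exponential series leaves y^2 times the series that defines [g]. *)
Lemma sub_heat_second_order : sub f (heat 1) = opp1 (mul g (mul A A)).
Proof.
  apply L1_ext; intros x Hx.
  rewrite tr_opp, !tr_mul, tr_sub, tr_heat by exact Hx.
  unfold g; rewrite <- (is_series_unique _ _ (tr_lsum _ second_order_summable x Hx)).
  set (y := tr A x).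
  assert (Hf : tr f x = 1 - y) by (unfold y, A; rewrite tr_sub, tr_one by exact Hx; ring).
  rewrite Hf; replace (- (1) * (1 - (1 - y))) with (- y) by ring.
  assert (H1 := Series_incr_1 _ (ex_intro _ _ (exp_is_series (- y)))).
  assert (H2 := Series_incr_1 _ (ex_intro _ _ (exp_shift_is_series (- y)))).
  rewrite (is_series_unique _ _ (exp_is_series (- y))) in H1.
  replace (Series (fun k => tr (scl ((-1) ^ k * / INR (fact (S (S k)))) (pw A k)) x) * (y * y))
    with (Series (fun k => / INR (fact (S (S k))) * (- y) ^ S (S k))).
  - rewrite H1, H2; simpl; field.
  - rewrite <- Series_scal_r; apply Series_ext; intros k.
    rewrite tr_scl, tr_pw by exact Hx; fold y.
    replace (- y) with (-1 * y) by ring; rewrite Rpow_mult_distr; simpl; ring.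
Qed.

(** * From the semigroup bound back to the powers *)

Variable C : R.
Hypothesis HC : forall t, 1 <= t -> t * nm (mul A (heat t)) <= C.
Hypothesis Ha0 : is_lim_seq a 0.

Let G : R := nm g.

Lemma C_nonneg : 0 <= C.
Proof.
  apply Rle_trans with (2 := HC 1 (Rle_refl 1)).
  apply Rmult_le_pos; [lra | apply nm_ge0].
Qed.

(** The semigroup is cut into two halves and each receives one factor A; t >= 2 puts t / 2 in the
    range of [HC]. *)
Lemma heat_second_order (t : R) :
  2 <= t -> nm (mul A (mul A (heat t))) <= 4 * C * C / (t * t).
Proof.
  intros Ht.
  assert (Hh : nm (mul A (heat (t / 2))) <= 2 * C / t).
  { apply Rmult_le_reg_l with (t / 2); [lra|].
    replace (t / 2 * (2 * C / t)) with C by (field; lra); apply HC; lra. }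
  replace (heat t) with (mul (heat (t / 2)) (heat (t / 2)))
    by (rewrite <- heat_add; f_equal; field).
  replace (mul A (mul A (mul (heat (t / 2)) (heat (t / 2)))))
    with (mul (mul A (heat (t / 2))) (mul A (heat (t / 2)))) by ring.
  replace (4 * C * C / (t * t)) with (2 * C / t * (2 * C / t)) by (field; lra).
  now apply nm_mul_le.
Qed.

Let D (j : nat) : L1 := sub (pw f j) (heat (INR j)).

(** F^{j+1} - e^{-(j+1)A} = F (F^j - e^{-jA}) + (F - e^{-A}) e^{-jA}, with the last difference of
    second order in A. *)
Lemma D_step (j : nat) :
  D (S j) = sub (mul f (D j)) (mul g (mul A (mul A (heat (INR j))))).
Proof.
  unfold D; rewrite S_INR, Rplus_comm, heat_add; simpl pw.
  replace (heat 1) with (add f (mul g (mul A A))); [ring|].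
  transitivity (sub f (sub f (heat 1))); [rewrite sub_heat_second_order; ring | ring].
Qed.

(** Each of the first [J] errors carries A^2: one factor A is joined to F^m and gives a_m, the other
    costs 2. For fixed [J] the bound tends to 0 with a_m. *)
Lemma pw_D_bound (J m : nat) : nm (mul (pw f m) (D J)) <= INR J * (2 * G * a m).
Proof.
  revert m; induction J as [|J IH]; intros m.
  - unfold D; simpl; rewrite heat_0.
    replace (mul (pw f m) (sub one1 one1)) with (scl 0 one1) by (change (scl 0 one1) with zero1; ring).
    rewrite nm_scl, Rabs_R0; lra.
  - rewrite D_step.
    replace (mul (pw f m) (sub (mul f (D J)) (mul g (mul A (mul A (heat (INR J)))))))
      with (sub (mul (pw f (S m)) (D J)) (mul (mul (mul g A) (heat (INR J))) (mul (pw f m) A)))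
      by (simpl; ring).
    apply Rle_trans with (1 := nm_sub _ _).
    assert (H1 : nm (mul (mul (mul g A) (heat (INR J))) (mul (pw f m) A)) <= G * 2 * 1 * a m).
    { apply nm_mul_le; [|apply Rle_refl].
      apply nm_mul_le; [|apply heat_le1, pos_INR].
      apply nm_mul_le; [apply Rle_refl | apply nm_one_sub]. }
    assert (H2 := IH (S m)).
    assert (INR J * (2 * G * a (S m)) <= INR J * (2 * G * a m)).
    { apply Rmult_le_compat_l; [apply pos_INR|]; apply Rmult_le_compat_l; [|apply gap_decr].
      generalize (nm_ge0 g); fold G; lra. }
    rewrite S_INR; lra.
Qed.

(** Every step after [J] costs O(1/t^2) by [heat_second_order], and 1/t^2 <= 1/(t - 1) - 1/t
    telescopes. The bound is thus uniform in [m] and small for large [J]. *)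
Lemma D_tail (J m : nat) : (2 <= J)%nat ->
  nm (sub (D (J + m)) (mul (pw f m) (D J)))
    <= 4 * C * C * G * (/ (INR J - 1) - / (INR (J + m) - 1)).
Proof.
  intros HJ.
  assert (HJ2 : 2 <= INR J) by (replace 2 with (INR 2) by (simpl; ring); apply le_INR; lia).
  induction m as [|m IH].
  - rewrite Nat.add_0_r; simpl pw.
    replace (sub (D J) (mul one1 (D J))) with (scl 0 one1) by (change (scl 0 one1) with zero1; ring).
    rewrite nm_scl, Rabs_R0; right; ring.
  - replace (J + S m)%nat with (S (J + m)) by lia.
    rewrite D_step.
    replace (sub (sub (mul f (D (J + m))) (mul g (mul A (mul A (heat (INR (J + m)))))))
                 (mul (pw f (S m)) (D J)))
      with (sub (mul f (sub (D (J + m)) (mul (pw f m) (D J))))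
                (mul g (mul A (mul A (heat (INR (J + m))))))) by (simpl; ring).
    apply Rle_trans with (1 := nm_sub _ _).
    set (t := INR (J + m)) in *.
    assert (Ht : 2 <= t) by (unfold t; rewrite plus_INR; generalize (pos_INR m); lra).
    assert (H1 : nm (mul f (sub (D (J + m)) (mul (pw f m) (D J))))
                 <= 1 * (4 * C * C * G * (/ (INR J - 1) - / (t - 1))))
      by (apply nm_mul_le; assumption).
    assert (H2 : nm (mul g (mul A (mul A (heat t)))) <= G * (4 * C * C / (t * t)))
      by (apply nm_mul_le; [apply Rle_refl | now apply heat_second_order]).
    assert (H3 : / (t * t) <= / (t - 1) - / t).
    { replace (/ (t - 1) - / t) with (/ (t * (t - 1))) by (field; lra).
      apply Rinv_le_contravar; nra. }
    assert (HG : 0 <= G) by apply nm_ge0.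
    assert (HCC : 0 <= C * C) by apply Rle_0_sqr.
    assert (H4 : (4 * C * C * G) * / (t * t) <= (4 * C * C * G) * (/ (t - 1) - / t)).
    { apply Rmult_le_compat_l; [nra | exact H3]. }
    rewrite S_INR; fold t.
    replace (t + 1 - 1) with t by ring.
    unfold Rdiv in H2; lra.
Qed.

(** The order of the choices matters: [J] is fixed so that the steps beyond it contribute at most
    eps / 2; then N is taken so large that F^{N-J} reduces the first [J] steps to eps / 2. *)
Lemma D_small (eps : R) : 0 < eps -> exists N0, forall N, (N0 <= N)%nat -> nm (D N) <= eps.
Proof.
  intros Heps.
  assert (HG : 0 <= G) by apply nm_ge0.
  assert (HCC : 0 <= C * C) by apply Rle_0_sqr.
  assert (HK : 0 <= 4 * C * C * G) by nra.
  destruct (nfloor_ex (2 * (4 * C * C * G) / eps)) as [j [_ Hj]].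
  { apply Rmult_le_pos; [lra | left; now apply Rinv_0_lt_compat]. }
  (* Adding 2 meets the condition 2 <= J of [D_tail] and makes its denominator J - 1 equal to j +
     1. *)
  set (J := (j + 2)%nat).
  assert (HJ : INR J - 1 = INR j + 1) by (unfold J; rewrite plus_INR; simpl; ring).
  assert (HjK : 4 * C * C * G * / (INR j + 1) <= eps / 2).
  { assert (Hp : 0 < INR j + 1) by (generalize (pos_INR j); lra).
    apply Rmult_le_reg_r with (INR j + 1); [exact Hp|].
    rewrite Rmult_assoc, Rinv_l, Rmult_1_r by lra.
    apply Rmult_lt_compat_r with (r := eps) in Hj; [|exact Heps].
    unfold Rdiv in Hj; rewrite Rmult_assoc, Rinv_l in Hj by lra; lra. }
  (* The summand 1 keeps [q] positive even if [G] vanishes. *)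
  set (q := 2 * G * INR J + 1).
  assert (Hq : 0 < q) by (unfold q; generalize (pos_INR J); intros; nra).
  assert (Hq2 : 0 < eps / (2 * q)) by (apply Rdiv_lt_0_compat; lra).
  destruct (proj2 (is_lim_seq_spec a 0) Ha0 (mkposreal _ Hq2)) as [n0 Hn0]; simpl in Hn0.
  exists (J + n0)%nat; intros N HN.
  replace N with (J + (N - J))%nat by lia; set (m := (N - J)%nat).
  assert (Hm : a m <= eps / (2 * q)).
  { assert (Hm := Hn0 m ltac:(unfold m; lia)).
    rewrite Rminus_0_r in Hm; generalize (Rle_abs (a m)); lra. }
  replace (D (J + m)) with (add (sub (D (J + m)) (mul (pw f m) (D J))) (mul (pw f m) (D J))) by ring.
  apply Rle_trans with (1 := nm_add _ _).
  assert (H1 := D_tail J m ltac:(unfold J; lia)).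
  assert (H2 := pw_D_bound J m).
  rewrite HJ in H1.
  assert (H3 : 0 <= 4 * C * C * G * / (INR (J + m) - 1)).
  { apply Rmult_le_pos; [exact HK|]; left; apply Rinv_0_lt_compat.
    rewrite plus_INR; generalize (pos_INR j) (pos_INR m); lra. }
  assert (H4 : INR J * (2 * G * a m) <= eps / 2).
  { apply Rle_trans with (q * (eps / (2 * q))); [|right; field; lra].
    replace (INR J * (2 * G * a m)) with ((2 * G * INR J) * a m) by ring.
    apply Rmult_le_compat; [generalize (pos_INR J); intros; nra | apply nm_ge0 | unfold q; lra | exact Hm]. }
  lra.
Qed.

Lemma gap_double (N : nat) : (1 <= N)%nat -> INR N * a (2 * N) <= C + nm (D N) * (INR N * a N).
Proof.
  intros HN.
  assert (HN1 : 1 <= INR N) by (apply (le_INR 1); exact HN).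
  replace (a (2 * N)) with
    (nm (add (mul (mul A (heat (INR N))) (pw f N)) (mul (D N) (mul (pw f N) A)))).
  2:{ unfold a; f_equal; replace (2 * N)%nat with (N + N)%nat by lia.
      rewrite pw_add; unfold D; ring. }
  assert (H1 : nm (mul (mul A (heat (INR N))) (pw f N)) <= nm (mul A (heat (INR N))) * 1)
    by (apply nm_mul_le; [apply Rle_refl | apply nm_pw_le1]).
  assert (H2 : nm (mul (D N) (mul (pw f N) A)) <= nm (D N) * a N)
    by (apply nm_mul_le; apply Rle_refl).
  assert (H3 := HC (INR N) HN1).
  apply Rle_trans with (INR N * (nm (mul A (heat (INR N))) + nm (D N) * a N)).
  - apply Rmult_le_compat_l; [lra|]; apply Rle_trans with (1 := nm_add _ _); lra.
  - nra.
Qed.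

Lemma heat_ritt : exists M, forall n, INR n * a n <= M.
Proof.
  (* With N = n / 2 one has n <= 3N, so n a_n <= 3 (N a_{2N}) <= 3C + 3 d_N B. For d_N <= 1/6 this
     is at most 3C + B/2, hence at most B once B >= 6C. The second summand of [B] covers the small
     n, where a_n <= 2. *)
  destruct (D_small (1 / 6) ltac:(lra)) as [N0 HN0].
  set (B := 6 * C + (2 * INR (2 * N0 + 2))).
  assert (HC0 := C_nonneg).
  exists B; intros n.
  induction n as [n IH] using lt_wf_ind.
  destruct (Nat.lt_ge_cases n (2 * N0 + 2)) as [Hn|Hn].
  - assert (INR n * a n <= INR (2 * N0 + 2) * 2).
    { apply Rmult_le_compat; [apply pos_INR | apply nm_ge0 | apply le_INR; lia | apply gap_le2]. }
    unfold B; lra.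
  - set (N := (n / 2)%nat).
    assert (Hn2 : (2 * N <= n <= 2 * N + 1)%nat).
    { unfold N; generalize (Nat.div_mod_eq n 2) (Nat.mod_upper_bound n 2); lia. }
    assert (H1 := IH N ltac:(lia)).
    assert (H2 := HN0 N ltac:(lia)).
    assert (H3 := gap_double N ltac:(lia)).
    assert (H4 : INR n * a n <= (3 * INR N) * a (2 * N)).
    { apply Rmult_le_compat; [apply pos_INR | apply nm_ge0 | | apply gap_antitone; lia].
      replace (3 * INR N) with (INR (3 * N)) by (rewrite mult_INR; simpl; ring).
      apply le_INR; lia. }
    assert (H5 : nm (D N) * (INR N * a N) <= 1 / 6 * B).
    { apply Rmult_le_compat; [apply nm_ge0 | | exact H2 | exact H1].
      apply Rmult_le_pos; [apply pos_INR | apply nm_ge0]. }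
    assert (0 <= INR (2 * N0 + 2)) by apply pos_INR.
    unfold B in *; nra.
Qed.

End Contraction.

(** * Overlapping convolution powers *)

Lemma sum_f_R0_term (u : nat -> R) (n i : nat) :
  (forall k, 0 <= u k) -> (i <= n)%nat -> u i <= sum_f_R0 u n.
Proof.
  intros Hu; induction n as [|n IH]; intros Hi.
  - replace i with 0%nat by lia; apply Rle_refl.
  - simpl; destruct (Nat.eq_dec i (S n)) as [->|Hne].
    + assert (0 <= sum_f_R0 u n) by now apply cond_pos_sum. lra.
    + assert (H := IH ltac:(lia)); generalize (Hu (S n)); lra.
Qed.

Definition nonneg_seq (b : L1) : Prop := forall n, 0 <= b n.

Lemma nm_nonneg (b : L1) : nonneg_seq b -> nm b = Series b.
Proof. intros Hb; apply Series_ext; intros n; now apply Rabs_pos_eq. Qed.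

Lemma nonneg_ex_series (b : L1) : ex_series b.
Proof. apply ex_series_Rabs, coef_summable. Qed.

Lemma nonneg_mul (b c : L1) : nonneg_seq b -> nonneg_seq c -> nonneg_seq (mul b c).
Proof.
  intros Hb Hc n; apply cond_pos_sum; intros k; apply Rmult_le_pos; [apply Hb | apply Hc].
Qed.

Lemma nonneg_one : nonneg_seq one1.
Proof. intros [|n]; simpl; lra. Qed.

Lemma nonneg_pw (b : L1) (n : nat) : nonneg_seq b -> nonneg_seq (pw b n).
Proof.
  intros Hb; induction n as [|n IH]; [apply nonneg_one | now apply nonneg_mul].
Qed.

Lemma nm_mul_nonneg (b c : L1) :
  nonneg_seq b -> nonneg_seq c -> nm (mul b c) = nm b * nm c.
Proof.
  intros Hb Hc.
  rewrite <- (is_series_unique _ _ (abs_mult_is_series b c)), nm_nonneg by now apply nonneg_mul.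
  apply Series_ext; intros n; apply sum_eq; intros k _.
  rewrite !Rabs_pos_eq; auto.
Qed.

Lemma nm_add_nonneg (b c : L1) :
  nonneg_seq b -> nonneg_seq c -> nm (add b c) = nm b + nm c.
Proof.
  intros Hb Hc; unfold nm; rewrite <- Series_plus by apply coef_summable.
  apply Series_ext; intros n; simpl.
  rewrite !Rabs_pos_eq; auto; generalize (Hb n) (Hc n); lra.
Qed.

(** On nonnegative sequences the norm is additive, so removing a minorant removes exactly its
    mass. *)
Lemma nm_sub_below (b c : L1) :
  nonneg_seq c -> (forall n, c n <= b n) -> nonneg_seq (sub b c) /\ nm (sub b c) = nm b - nm c.
Proof.
  intros Hc Hcb.
  assert (Hw : nonneg_seq (sub b c)) by (intros n; simpl; generalize (Hcb n); lra).
  split; [exact Hw|].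
  replace (nm b) with (nm (add (sub b c) c)) by (f_equal; ring).
  rewrite nm_add_nonneg by assumption; ring.
Qed.

Lemma nm_pw_nonneg (b : L1) (n : nat) : nonneg_seq b -> nm (pw b n) = nm b ^ n.
Proof.
  intros Hb; induction n as [|n IH]; simpl; [apply nm_one|].
  rewrite nm_mul_nonneg, IH; auto using nonneg_pw.
Qed.

Lemma mul_coef_ge (b c : L1) (m n : nat) (x y : R) :
  nonneg_seq b -> nonneg_seq c -> 0 <= x <= b m -> 0 <= y <= c n -> x * y <= mul b c (m + n)%nat.
Proof.
  intros Hb Hc Hx Hy.
  apply Rle_trans with (b m * c (m + n - m)%nat).
  - replace (m + n - m)%nat with n by lia; apply Rmult_le_compat; tauto.
  - apply (sum_f_R0_term (fun k => b k * c (m + n - k)%nat)); [|lia].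
    intros k; now apply Rmult_le_pos.
Qed.

Definition seq_point (t n : nat) : R := if Nat.eq_dec n t then 1 else 0.

Lemma sum_point (t : nat) (u : nat -> R) (N : nat) :
  sum_f_R0 (fun k => seq_point t k * u k) N = if le_dec t N then u t else 0.
Proof.
  induction N as [|N IH]; simpl.
  - unfold seq_point; destruct t as [|t]; simpl; ring.
  - rewrite IH; unfold seq_point.
    destruct (Nat.eq_dec (S N) t) as [E|E]; destruct (le_dec t N); destruct (le_dec t (S N));
      try lia; try (rewrite E); ring.
Qed.

Lemma sum_n_point (t N : nat) :
  sum_n (fun n => Rabs (seq_point t n)) N = if le_dec t N then 1 else 0.
Proof.
  rewrite sum_n_Reals, <- (sum_point t (fun _ => 1)).
  apply sum_eq; intros i _; unfold seq_point; destruct (Nat.eq_dec i t);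
    rewrite ?Rabs_R0, ?Rabs_R1; ring.
Qed.

Lemma seq_point_summable (t : nat) : ex_series (fun n => Rabs (seq_point t n)).
Proof.
  apply (ex_series_bounded _ 1); [intros; apply Rabs_pos|].
  intros N; rewrite sum_n_point; destruct (le_dec t N); lra.
Qed.

Definition point (t : nat) : L1 := mkL1 (seq_point t) (seq_point_summable t).

Lemma nm_point (t : nat) : nm (point t) = 1.
Proof.
  apply is_series_unique, lim_sum_is_series.
  apply (is_lim_seq_ext_loc (fun _ => 1)); [|apply is_lim_seq_const].
  exists t; intros n Hn; symmetry; simpl.
  rewrite sum_n_point; destruct (le_dec t n); [reflexivity | lia].
Qed.

Lemma nonneg_point (t : nat) : nonneg_seq (point t).
Proof. intros n; simpl; unfold seq_point; destruct (Nat.eq_dec n t); lra. Qed.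

Lemma point_mul (t : nat) (b : L1) (n : nat) :
  mul (point t) b n = if le_dec t n then b (n - t)%nat else 0.
Proof. exact (sum_point t (fun k => b (n - k)%nat) n). Qed.

Lemma nonneg_scl (c : R) (b : L1) : 0 <= c -> nonneg_seq b -> nonneg_seq (scl c b).
Proof. intros Hc Hb n; simpl; now apply Rmult_le_pos. Qed.

Lemma scl_mul_l (c : R) (a b : L1) : mul (scl c a) b = scl c (mul a b).
Proof. by_tr. Qed.

(** * Subgroups of the integers and periods of the circular functions *)

(** Division with remainder by the least positive element, found classically since [P] is arbitrary.
    Closure under differences already yields negatives, sums and multiples. *)
Lemma subgroup_Z (P : Z -> Prop) :
  P 0%Z -> (forall d e, P d -> P e -> P (d - e)%Z) ->
  (forall d, P d -> d = 0%Z) \/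
  exists d, (0 < d)%Z /\ forall e, P e <-> (d | e)%Z.
Proof.
  intros P0 Psub.
  assert (Popp : forall d, P d -> P (- d)%Z).
  { intros d Hd; replace (- d)%Z with (0 - d)%Z by lia; now apply Psub. }
  assert (Padd : forall d e, P d -> P e -> P (d + e)%Z).
  { intros d e Hd He; replace (d + e)%Z with (d - (- e))%Z by lia; auto. }
  assert (Pnat : forall d (n : nat), P d -> P (Z.of_nat n * d)%Z).
  { intros d n Hd; induction n as [|n IH]; [exact P0|].
    replace (Z.of_nat (S n) * d)%Z with (Z.of_nat n * d + d)%Z by lia; auto. }
  assert (Pmul : forall d m, P d -> P (m * d)%Z).
  { intros d m Hd; destruct (Z.le_ge_cases 0 m).
    - replace m with (Z.of_nat (Z.to_nat m)) by lia; auto.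
    - replace (m * d)%Z with (- (Z.of_nat (Z.to_nat (- m)) * d))%Z
        by (rewrite Z2Nat.id by lia; ring); auto. }
  destruct (classic (exists n : nat, (0 < n)%nat /\ P (Z.of_nat n))) as [[n [Hn HPn]]|Hno].
  - right.
    assert (Hmin : exists m : nat, ((0 < m)%nat /\ P (Z.of_nat m)) /\
              forall m', (0 < m')%nat /\ P (Z.of_nat m') -> (m <= m')%nat).
    { destruct (Wf_nat.dec_inh_nat_subset_has_unique_least_element
                  (fun m => (0 < m)%nat /\ P (Z.of_nat m))) as [m [[Hm Hle] _]].
      - intros m; apply classic.
      - now exists n.
      - exists m; split; [exact Hm | exact Hle]. }
    destruct Hmin as [m [[Hm HPm] Hle]].
    exists (Z.of_nat m); split; [lia|].
    intros e; split.
    + intros He; apply Z.mod_divide; [lia|].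
      assert (Hr := Z.mod_pos_bound e (Z.of_nat m) ltac:(lia)).
      assert (HPr : P (e mod Z.of_nat m)%Z).
      { replace (e mod Z.of_nat m)%Z with (e - (e / Z.of_nat m) * Z.of_nat m)%Z
          by (rewrite (Z.div_mod e (Z.of_nat m)) at 1 by lia; ring).
        auto. }
      set (r := (e mod Z.of_nat m)%Z) in *; clearbody r.
      destruct (Z.eq_dec r 0) as [E|Hne]; [exact E|].
      assert (H : (m <= Z.to_nat r)%nat).
      { apply Hle; split; [lia | rewrite Z2Nat.id by lia; exact HPr]. }
      lia.
    + intros [q ->]; auto.
  - left; intros d Hd; destruct (Z.lt_trichotomy d 0) as [Hlt|[E|Hgt]]; [|exact E|]; exfalso; apply Hno.
    + exists (Z.to_nat (- d)); split; [lia|]; rewrite Z2Nat.id by lia; auto.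
    + exists (Z.to_nat d); split; [lia|]; rewrite Z2Nat.id by lia; auto.
Qed.

Lemma cos_sin_period_Z (x : R) (m : Z) :
  cos (x + 2 * IZR m * PI) = cos x /\ sin (x + 2 * IZR m * PI) = sin x.
Proof.
  destruct (Z.le_ge_cases 0 m) as [Hm|Hm].
  - replace (IZR m) with (INR (Z.to_nat m)) by (rewrite INR_IZR_INZ, Z2Nat.id by lia; reflexivity).
    now rewrite cos_period, sin_period.
  - set (y := x + 2 * IZR m * PI).
    replace x with (y + 2 * INR (Z.to_nat (- m)) * PI).
    + now rewrite cos_period, sin_period.
    + unfold y; rewrite INR_IZR_INZ, Z2Nat.id, opp_IZR by lia; ring.
Qed.

Lemma cos_eq_1 (x : R) : cos x = 1 -> exists m : Z, x = 2 * IZR m * PI.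
Proof.
  intros H; replace x with (2 * (x / 2)) in H by field.
  rewrite cos_2a_sin in H.
  destruct (sin_eq_0_0 (x / 2)) as [m Hm]; [nra|].
  exists m; lra.
Qed.

(** * Decay of the gaps of a probability sequence *)

Section Probability.

Variable f : L1.
Hypothesis f_nonneg : nonneg_seq f.
Hypothesis f_mass : nm f = 1.

Let A : L1 := sub one1 f.
Let a (n : nat) : R := nm (mul (pw f n) A).

Lemma nm_pw_prob (n : nat) : nm (pw f n) = 1.
Proof. rewrite nm_pw_nonneg, f_mass by exact f_nonneg; apply pow1. Qed.

(** The geometric sum has norm j + 1 while its product with A has norm at most 2: this ratio is the
    source of the decay. *)
Lemma geometric_A (j : nat) : mul A (psum (pw f) j) = sub one1 (pw f (S j)).
Proof.
  induction j as [|j IH]; [unfold A; simpl; ring|].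
  change (psum (pw f) (S j)) with (add (psum (pw f) j) (pw f (S j))).
  transitivity (add (mul A (psum (pw f) j)) (mul A (pw f (S j)))); [ring|].
  rewrite IH; unfold A; simpl; ring.
Qed.

Lemma nonneg_psum (j : nat) : nonneg_seq (psum (pw f) j).
Proof.
  induction j as [|j IH]; [apply nonneg_one|].
  intros n; generalize (IH n) (nonneg_pw f (S j) f_nonneg n); simpl; lra.
Qed.

Lemma nm_psum (j : nat) : nm (psum (pw f) j) = INR j + 1.
Proof.
  induction j as [|j IH]; [simpl; rewrite nm_one; ring|].
  change (psum (pw f) (S j)) with (add (psum (pw f) j) (pw f (S j))).
  rewrite nm_add_nonneg, IH, nm_pw_prob, S_INR; auto using nonneg_psum, nonneg_pw.
Qed.

Section Overlap.

Variables (k s : nat) (c : R).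
Hypothesis c_pos : 0 < c.
Hypothesis overlap0 : c <= pw f k s.
Hypothesis overlap1 : c <= pw f (S k) s.

(** The exponent jk + i is made of i blocks of length k + 1 and j - i blocks of length k. Each block
    puts mass at least c at [s], so together they put at least c^j at [j * s]. *)
Lemma overlap_iter (j i : nat) : (i <= j)%nat -> c ^ j <= pw f (j * k + i) (j * s)%nat.
Proof.
  revert i; induction j as [|j IH]; intros i Hi.
  - replace i with 0%nat by lia; simpl; lra.
  - destruct (Nat.eq_dec i (S j)) as [->|Hne].
    + replace (S j * k + S j)%nat with (S k + (j * k + j))%nat by lia.
      rewrite pw_add; apply mul_coef_ge; auto using nonneg_pw.
      * split; [lra | exact overlap1].
      * split; [apply pow_le; lra | apply IH; lia].
    + replace (S j * k + i)%nat with (k + (j * k + i))%nat by lia.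
      rewrite pw_add; apply mul_coef_ge; auto using nonneg_pw.
      * split; [lra | exact overlap0].
      * split; [apply pow_le; lra | apply IH; lia].
Qed.

Let L (j : nat) : nat := (j * k + j)%nat.

(** F^{jk+j} = F^{jk+(j-i)} F^i, where the first factor has mass at least c^j at [j * s]. The point
    does not depend on [i], so these minorants can be averaged over [i]. *)
Lemma overlap_shift (j i n : nat) : (i <= j)%nat ->
  c ^ j * mul (point (j * s)) (pw f i) n <= pw f (L j) n.
Proof.
  intros Hi; rewrite point_mul.
  destruct (le_dec (j * s) n) as [Hn|Hn].
  - replace (L j) with ((j * k + (j - i)) + i)%nat by (unfold L; lia).
    rewrite pw_add; replace n with (j * s + (n - j * s))%nat at 2 by lia.
    apply mul_coef_ge; auto using nonneg_pw.
    + split; [apply pow_le; lra | apply overlap_iter; lia].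
    + split; [now apply nonneg_pw | apply Rle_refl].
  - rewrite Rmult_0_r; now apply nonneg_pw.
Qed.

Lemma overlap_sum (j i n : nat) : (i <= j)%nat ->
  c ^ j * mul (point (j * s)) (psum (pw f) i) n <= (INR i + 1) * pw f (L j) n.
Proof.
  induction i as [|i IH]; intros Hi.
  - replace (INR 0 + 1) with 1 by (simpl; ring); rewrite Rmult_1_l.
    exact (overlap_shift j 0 n Hi).
  - change (psum (pw f) (S i)) with (add (psum (pw f) i) (pw f (S i))).
    replace (mul (point (j * s)) (add (psum (pw f) i) (pw f (S i))))
      with (add (mul (point (j * s)) (psum (pw f) i)) (mul (point (j * s)) (pw f (S i)))) by ring.
    generalize (IH ltac:(lia)) (overlap_shift j (S i) n Hi); intros H1 H2.
    rewrite S_INR; cbn [coef add]; lra.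
Qed.

(** F^{jk+j} = v + w, where v = q delta_{js} (1 + F + ... + F^j) has mass c^j. Then A v = q
    delta_{js} (1 - F^{j+1}) has norm at most 2q, and w, of mass 1 - c^j, multiplies a_n by at most
    that mass. *)
Lemma gap_contract (j n : nat) :
  a (n + L j) <= 2 * c ^ j / (INR j + 1) + (1 - c ^ j) * a n.
Proof.
  assert (Hj : 0 < INR j + 1) by (generalize (pos_INR j); lra).
  assert (Hcj : 0 < c ^ j) by now apply pow_lt.
  assert (Hq : 0 < c ^ j / (INR j + 1)) by now apply Rdiv_lt_0_compat.
  set (q := c ^ j / (INR j + 1)) in *.
  set (v := scl q (mul (point (j * s)) (psum (pw f) j))).
  assert (Hv : nonneg_seq v).
  { apply nonneg_scl; [lra|]; apply nonneg_mul; [apply nonneg_point | apply nonneg_psum]. }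
  assert (Hvf : forall i, v i <= pw f (L j) i).
  { intros i; assert (H := overlap_sum j j i (le_n j)).
    unfold v; cbn [coef scl]; unfold q.
    apply Rmult_le_reg_l with (1 := Hj).
    replace ((INR j + 1) * (c ^ j / (INR j + 1) * mul (point (j * s)) (psum (pw f) j) i))
      with (c ^ j * mul (point (j * s)) (psum (pw f) j) i) by (field; lra).
    exact H. }
  assert (Hnv : nm v = c ^ j).
  { unfold v; rewrite nm_scl, Rabs_pos_eq, nm_mul_nonneg, nm_point, nm_psum
      by (try lra; auto using nonneg_point, nonneg_psum).
    unfold q; field; lra. }
  destruct (nm_sub_below _ _ Hv Hvf) as [_ Hw].
  rewrite nm_pw_prob, Hnv in Hw.
  set (w := sub (pw f (L j)) v) in *.
  replace (a (n + L j)) with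
    (nm (add (scl q (mul (mul (pw f n) (point (j * s))) (sub one1 (pw f (S j)))))
             (mul w (mul (pw f n) A)))).
  - apply Rle_trans with (1 := nm_add _ _).
    assert (H1 : nm (mul w (mul (pw f n) A)) <= (1 - c ^ j) * a n)
      by (apply nm_mul_le; [lra | apply Rle_refl]).
    assert (H2 : nm (mul (mul (pw f n) (point (j * s))) (sub one1 (pw f (S j)))) <= (1 * 1) * 2).
    { apply nm_mul_le.
      - apply nm_mul_le; [rewrite nm_pw_prob | rewrite nm_point]; apply Rle_refl.
      - apply Rle_trans with (1 := nm_sub _ _); rewrite nm_one, nm_pw_prob; lra. }
    rewrite nm_scl, Rabs_pos_eq by lra.
    replace (2 * c ^ j / (INR j + 1)) with (q * 2) by (unfold q; field; lra).
    assert (q * nm (mul (mul (pw f n) (point (j * s))) (sub one1 (pw f (S j)))) <= q * 2)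
      by (apply Rmult_le_compat_l; lra).
    lra.
  - unfold a; f_equal; rewrite pw_add, <- geometric_A.
    replace (pw f (L j)) with (add w v) by (unfold w; ring).
    unfold v; rewrite <- scl_mul_l.
    transitivity (add (mul (mul (mul (pw f n) (scl q (point (j * s)))) (psum (pw f) j)) A)
                      (mul w (mul (pw f n) A))).
    + f_equal; by_tr.
    + replace (scl q (mul (point (j * s)) (psum (pw f) j)))
        with (mul (scl q (point (j * s))) (psum (pw f) j)) by by_tr.
      ring.
Qed.

Lemma overlap_gap_to_0 : is_lim_seq a 0.
Proof.
  assert (Hdec : forall n, a (S n) <= a n) by (intros n; apply (gap_decr f); lra).
  destruct (ex_finite_lim_seq_decr a 0 Hdec (fun n => nm_ge0 _)) as [l Hl].
  assert (Hl0 : 0 <= l)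
    by exact (is_lim_seq_le (fun _ => 0) a 0 l (fun n => nm_ge0 _) (is_lim_seq_const 0) Hl).
  assert (Hlj : forall j, l * (INR j + 1) <= 2).
  { intros j.
    assert (Hj : 0 < INR j + 1) by (generalize (pos_INR j); lra).
    assert (Hcj : 0 < c ^ j) by now apply pow_lt.
    assert (H : l <= 2 * c ^ j / (INR j + 1) + (1 - c ^ j) * l).
    { apply (is_lim_seq_le (fun n => a (n + L j)%nat)
               (fun n => 2 * c ^ j / (INR j + 1) + (1 - c ^ j) * a n) l
               (2 * c ^ j / (INR j + 1) + (1 - c ^ j) * l)).
      - intros n; apply gap_contract.
      - now apply is_lim_seq_incr_n.
      - apply is_lim_seq_plus'; [apply is_lim_seq_const|].
        apply (is_lim_seq_scal_l a (1 - c ^ j) l Hl). }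
    (* The factor c^j, however small, cancels; so no lower bound on the common mass [c] is required
       beyond positivity. *)
    assert (H' : c ^ j * l <= c ^ j * (2 / (INR j + 1))) by (unfold Rdiv in *; lra).
    apply Rmult_le_reg_l in H'; [|exact Hcj].
    apply Rmult_le_compat_r with (r := INR j + 1) in H'; [|lra].
    replace (2 / (INR j + 1) * (INR j + 1)) with 2 in H' by (field; lra).
    exact H'. }
  replace 0 with l; [exact Hl|].
  destruct (Rle_lt_or_eq_dec 0 l Hl0) as [Hpos|E]; [|now symmetry].
  destruct (nfloor_ex (2 / l)) as [j [_ Hj]]; [left; apply Rdiv_lt_0_compat; lra|].
  apply Rmult_lt_compat_r with (r := l) in Hj; [|exact Hpos].
  unfold Rdiv in Hj; rewrite Rmult_assoc, Rinv_l in Hj by lra.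
  generalize (Hlj j); lra.
Qed.

End Overlap.

(** * An atom common to two consecutive powers *)

Lemma mul_coef_pos (b c : L1) (m n : nat) :
  nonneg_seq b -> nonneg_seq c -> 0 < b m -> 0 < c n -> 0 < mul b c (m + n)%nat.
Proof.
  intros Hb Hc Hm Hn; apply Rlt_le_trans with (b m * c n); [now apply Rmult_lt_0_compat|].
  apply mul_coef_ge; auto; lra.
Qed.

Lemma exists_atom : exists t, 0 < f t.
Proof.
  apply NNPP; intros H.
  assert (E : nm f = nm (scl 0 one1)).
  { unfold nm; apply Series_ext; intros n; simpl; f_equal.
    destruct (Rle_lt_or_eq_dec _ _ (f_nonneg n)) as [Hp|E]; [exfalso; eauto | lra]. }
  rewrite f_mass, nm_scl, Rabs_R0 in E; lra.
Qed.

(** The two atoms belong to the same power. Letting the exponent [r] vary makes the set a subgroup,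
    since atoms of F^r and F^{r'} add up to atoms of F^{r+r'}. *)
Let diff (d : Z) : Prop :=
  exists r s t, 0 < pw f r s /\ 0 < pw f r t /\ d = (Z.of_nat s - Z.of_nat t)%Z.

Lemma diff_sub (d e : Z) : diff d -> diff e -> diff (d - e).
Proof.
  intros (r & s & t & Hs & Ht & ->) (r' & s' & t' & Hs' & Ht' & ->).
  exists (r + r')%nat, (s + t')%nat, (t + s')%nat.
  rewrite pw_add; repeat split; try (apply mul_coef_pos; auto using nonneg_pw).
  lia.
Qed.

Lemma diff_0 : diff 0.
Proof.
  exists 0%nat, 0%nat, 0%nat; simpl; repeat split; lra.
Qed.

Lemma pw1_coef (t : nat) : pw f 1 t = f t.
Proof. replace (pw f 1) with f by (simpl; ring); reflexivity. Qed.

Lemma diff_atoms (s t : nat) : 0 < f s -> 0 < f t -> diff (Z.of_nat s - Z.of_nat t).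
Proof. intros Hs Ht; exists 1%nat, s, t; rewrite !pw1_coef; auto. Qed.

(* The differences of equally long sums of atoms form a subgroup [d Z]; all atoms agree
   modulo [d], and the hypothesis tested at [2 PI / d] puts them in [d Z]. *)
Lemma aperiodic_overlap :
  (forall xi t, - PI <= xi <= PI -> 0 < f t ->
     (forall n, 0 < f n -> cos (INR n * xi) = cos (INR t * xi) /\
                           sin (INR n * xi) = sin (INR t * xi)) ->
     cos (INR t * xi) = 1) ->
  exists k s, 0 < pw f k s /\ 0 < pw f (S k) s.
Proof.
  intros Hap.
  destruct exists_atom as [t Ht].
  assert (HPI := PI_RGT_0).
  (* If t = s - u with s and u atoms of F^r, then s = t + u is an atom of F^r and of F^{r+1}: the
     required overlap. *)
  assert (Hd : diff (Z.of_nat t)).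
  { destruct (subgroup_Z diff diff_0 diff_sub) as [Htriv|[d [Hd Hdiv]]].
    (* Here [t] is the only atom. For t > 0 the test point PI / t gives the phase cos PI = -1. *)
    - destruct (Nat.eq_dec t 0) as [->|Hne]; [exact diff_0|exfalso].
      assert (Ht1 : 1 <= INR t) by (apply (le_INR 1); lia).
      assert (H : cos (INR t * (PI / INR t)) = 1).
      { apply Hap; [|exact Ht|].
        - assert (0 < / INR t) by (apply Rinv_0_lt_compat; lra).
          assert (/ INR t <= 1) by (rewrite <- Rinv_1; apply Rinv_le_contravar; lra).
          unfold Rdiv; nra.
        - intros n Hn; assert (E := Htriv _ (diff_atoms n t Hn Ht)).
          replace n with t by lia; auto. }
      replace (INR t * (PI / INR t)) with PI in H by (field; lra).
      rewrite cos_PI in H; lra.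
    - apply Hdiv.
      (* For d = 1 divisibility is automatic; d >= 2 is what puts 2 PI / d inside [- PI, PI]. *)
      destruct (Z.eq_dec d 1) as [->|Hd1]; [apply Z.divide_1_l|].
      assert (Hd2 : 2 <= IZR d) by (apply IZR_le; lia).
      destruct (cos_eq_1 (INR t * (2 * PI / IZR d))) as [m Hm].
      + apply Hap; [|exact Ht|].
        * assert (0 < / IZR d) by (apply Rinv_0_lt_compat; lra).
          assert (/ IZR d <= / 2) by (apply Rinv_le_contravar; lra).
          unfold Rdiv; nra.
        * intros n Hn.
          destruct (proj1 (Hdiv _) (diff_atoms n t Hn Ht)) as [q Hq].
          assert (E : INR n = INR t + IZR q * IZR d).
          { rewrite !INR_IZR_INZ, <- mult_IZR, <- plus_IZR; f_equal; lia. }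
          replace (INR n * (2 * PI / IZR d)) with (INR t * (2 * PI / IZR d) + 2 * IZR q * PI)
            by (rewrite E; field; lra).
          apply cos_sin_period_Z.
      + exists m; apply eq_IZR; rewrite mult_IZR, <- INR_IZR_INZ.
        apply Rmult_eq_reg_r with (2 * PI / IZR d).
        * rewrite Hm; field; lra.
        * apply Rgt_not_eq, Rdiv_lt_0_compat; lra. }
  destruct Hd as (r & s & u & Hs & Hu & E).
  exists r, s; split; [exact Hs|].
  replace s with (t + u)%nat by lia.
  now apply mul_coef_pos; auto using nonneg_pw.
Qed.

Lemma aperiodic_gap_to_0 :
  (forall xi t, - PI <= xi <= PI -> 0 < f t ->
     (forall n, 0 < f n -> cos (INR n * xi) = cos (INR t * xi) /\
                           sin (INR n * xi) = sin (INR t * xi)) ->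
     cos (INR t * xi) = 1) ->
  is_lim_seq a 0.
Proof.
  intros Hap; destruct (aperiodic_overlap Hap) as (k & s & H0 & H1).
  apply (overlap_gap_to_0 k s (Rmin (pw f k s) (pw f (S k) s))).
  - now apply Rmin_pos.
  - apply Rmin_l.
  - apply Rmin_r.
Qed.

End Probability.

(** * Series in complex Banach spaces *)

(** [lim] is specified only on proper Cauchy filters. Convergence makes the filter of partial sums
    Cauchy, and uniqueness of limits identifies the two values. *)
Lemma series_lim_eq {K : AbsRing} {V : CompleteNormedModule K} (a : nat -> V) (l : V) :
  is_series a l -> series_lim a = l.
Proof.
  intros H.
  assert (PF : ProperFilter (filtermap (sum_n a) eventually))
    by apply filtermap_proper_filter, eventually_filter.
  apply (filterlim_locally_unique (F := eventually) (sum_n a)); [|exact H].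
  apply filterlim_locally; intros eps.
  apply (complete_cauchy (filtermap (sum_n a) eventually) PF).
  intros e; exists l; exact (proj1 (filterlim_locally (sum_n a) l) H e).
Qed.

Section Module.

Context {X : CompleteNormedModule C_AbsRing}.

Lemma is_series_of_bound (a : nat -> X) (l : X) (r : nat -> R) :
  (forall N, norm (minus (sum_n a N : X) l) <= r N) -> is_lim_seq r 0 -> is_series a l.
Proof.
  intros Hr Hr0.
  apply filterlim_locally; intros eps.
  destruct (proj2 (is_lim_seq_spec r 0) Hr0 eps) as [N HN].
  exists N; intros n Hn; apply norm_compat1.
  apply Rle_lt_trans with (1 := Hr n).
  generalize (HN n Hn) (Rle_abs (r n - 0)); lra.
Qed.

Lemma is_series_norm (a : nat -> X) (l : X) :
  is_series a l -> is_lim_seq (fun N => norm (minus (sum_n a N : X) l)) 0.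
Proof.
  intros H; apply is_lim_seq_spec; intros eps.
  destruct (proj1 (filterlim_locally_ball_norm _ _) H eps) as [N HN].
  exists N; intros n Hn; rewrite Rminus_0_r, Rabs_pos_eq by apply norm_ge_0.
  exact (HN n Hn).
Qed.

Lemma norm_series_le (a : nat -> X) (l : X) (B : R) :
  is_series a l -> (forall N, norm (sum_n a N) <= B) -> norm l <= B.
Proof.
  intros H HB.
  assert (Hn : is_lim_seq (fun N => norm (sum_n a N)) (norm l)).
  { apply (filterlim_comp _ _ _ (sum_n a) norm eventually (locally l) (locally (norm l)));
      [exact H | exact (@filterlim_norm C_AbsRing X l)]. }
  exact (is_lim_seq_le _ (fun _ => B) (norm l) B HB Hn (is_lim_seq_const B)).
Qed.

(** One expression for three objects: with u_k = T^k x it is Psi(a; T) x, with u_k = H(z - k) the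
    convolution a * H at z, and with u_k = w^k the generating function at w. *)
Definition wsum (a : L1) (u : nat -> X) : X :=
  series_lim (fun k => scal (RtoC (a k)) (u k)).

Lemma norm_scal_R (r : R) (x : X) : norm (scal (RtoC r) x) <= Rabs r * norm x.
Proof.
  apply Rle_trans with (1 := norm_scal (RtoC r) x), Req_le.
  f_equal; apply Cmod_R.
Qed.

Definition bounded_seq (M : R) (u : nat -> X) : Prop := forall k, norm (u k) <= M.

Lemma bounded_seq_shift (M : R) (u : nat -> X) (k : nat) :
  bounded_seq M u -> bounded_seq M (fun j => u (k + j)%nat).
Proof. intros H j; apply H. Qed.

Lemma wsum_term (a : L1) (u : nat -> X) (M : R) (k : nat) :
  bounded_seq M u -> norm (scal (RtoC (a k)) (u k)) <= M * Rabs (a k).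
Proof.
  intros Hu; apply Rle_trans with (1 := norm_scal_R _ _).
  rewrite Rmult_comm; apply Rmult_le_compat_r; [apply Rabs_pos | apply Hu].
Qed.

Lemma wsum_is_series (a : L1) (u : nat -> X) (M : R) :
  bounded_seq M u -> is_series (fun k => scal (RtoC (a k)) (u k)) (wsum a u).
Proof.
  intros Hu.
  assert (Hex : ex_series (fun k => scal (RtoC (a k)) (u k))).
  { apply ex_series_le with (fun k => M * Rabs (a k)).
    - intros k; now apply wsum_term.
    - apply @ex_series_scal with (V := R_NormedModule); apply coef_summable. }
  destruct Hex as [l Hl]; unfold wsum; now rewrite (series_lim_eq _ l Hl).
Qed.

Lemma wsum_unique (a : L1) (u : nat -> X) (l : X) :
  is_series (fun k => scal (RtoC (a k)) (u k)) l -> wsum a u = l.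
Proof. apply series_lim_eq. Qed.

Lemma wsum_ext (a : L1) (u v : nat -> X) : (forall k, u k = v k) -> wsum a u = wsum a v.
Proof. intros H; f_equal; apply functional_extensionality, H. Qed.

Lemma bounded_seq_ge0 (M : R) (u : nat -> X) : bounded_seq M u -> 0 <= M.
Proof. intros H; apply Rle_trans with (2 := H 0%nat), norm_ge_0. Qed.

Lemma norm_wsum (a : L1) (u : nat -> X) (M : R) :
  bounded_seq M u -> norm (wsum a u) <= M * nm a.
Proof.
  intros Hu; apply (norm_series_le _ _ _ (wsum_is_series a u M Hu)).
  intros N; apply Rle_trans with (sum_n (fun k => M * Rabs (a k)) N).
  - apply Rle_trans with (1 := norm_sum_n_m (fun k => scal (RtoC (a k)) (u k)) 0 N).
    apply (sum_n_mono (fun k => norm (scal (RtoC (a k)) (u k)))); intros k; now apply wsum_term.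
  - apply Rle_trans with (Series (fun k => M * Rabs (a k))).
    + apply sum_n_le_Series.
      * intros k; apply Rmult_le_pos; [now apply bounded_seq_ge0 with u | apply Rabs_pos].
      * apply @ex_series_scal with (V := R_NormedModule); apply coef_summable.
    + rewrite Series_scal_l; apply Rle_refl.
Qed.

Lemma wsum_add (a b : L1) (u : nat -> X) (M : R) :
  bounded_seq M u -> wsum (add a b) u = plus (wsum a u) (wsum b u).
Proof.
  intros Hu; apply wsum_unique.
  apply is_series_ext with
    (fun k => plus (scal (RtoC (a k)) (u k)) (scal (RtoC (b k)) (u k))).
  - intros k; rewrite <- scal_distr_r; f_equal; symmetry; apply RtoC_plus.
  - apply @is_series_plus; now apply wsum_is_series with M.
Qed.

Lemma wsum_scl (c : R) (a : L1) (u : nat -> X) (M : R) :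
  bounded_seq M u -> wsum (scl c a) u = scal (RtoC c) (wsum a u).
Proof.
  intros Hu; apply wsum_unique.
  apply is_series_ext with (fun k => scal (RtoC c) (scal (RtoC (a k)) (u k))).
  - intros k; rewrite scal_assoc; f_equal; symmetry; apply RtoC_mult.
  - apply @is_series_scal; now apply wsum_is_series with M.
Qed.

Lemma wsum_sub (a b : L1) (u : nat -> X) (M : R) :
  bounded_seq M u -> wsum (sub a b) u = minus (wsum a u) (wsum b u).
Proof.
  intros Hu; unfold sub, opp1.
  rewrite (wsum_add _ _ u M), (wsum_scl _ _ u M) by exact Hu.
  unfold minus; f_equal.
  transitivity (scal (opp (one : C_AbsRing)) (wsum b u)); [|exact (scal_opp_one (wsum b u))].
  f_equal; unfold opp, one; simpl; unfold Copp; simpl; unfold RtoC; f_equal; ring.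
Qed.

Lemma is_series_one_term (a : nat -> X) (t : nat) :
  (forall k, k <> t -> a k = zero) -> is_series a (a t).
Proof.
  intros H.
  apply is_series_of_bound with (fun N => if le_dec t N then 0 else norm (a t)).
  - intros N.
    assert (E : sum_n a N = if le_dec t N then a t else zero).
    { induction N as [|N IH].
      - rewrite sum_O; destruct (le_dec t 0); [f_equal; lia | apply H; lia].
      - rewrite sum_Sn, IH; destruct (Nat.eq_dec t (S N)) as [->|Hne].
        + destruct (le_dec (S N) N); [lia|]; destruct (le_dec (S N) (S N)); [|lia].
          apply plus_zero_l.
        + rewrite (H (S N)), plus_zero_r by auto.
          destruct (le_dec t N); destruct (le_dec t (S N)); try lia; reflexivity. }
    rewrite E; destruct (le_dec t N).
    + apply Req_le; transitivity (norm (zero : X)); [|exact norm_zero].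
      f_equal; exact (plus_opp_r (a t)).
    + apply Req_le; transitivity (norm (opp (a t))); [|exact (norm_opp (a t))].
      f_equal; exact (plus_zero_l (opp (a t))).
  - apply (is_lim_seq_ext_loc (fun _ => 0)); [|apply is_lim_seq_const].
    exists t; intros n Hn; destruct (le_dec t n); [reflexivity | lia].
Qed.

Lemma wsum_one (u : nat -> X) : wsum one1 u = u 0%nat.
Proof.
  apply wsum_unique.
  replace (u 0%nat) with (scal (RtoC (one1 0%nat)) (u 0%nat)) by exact (scal_one (u 0%nat)).
  apply (is_series_one_term (fun k => scal (RtoC (one1 k)) (u k))).
  intros [|k] Hk; [congruence|]; exact (scal_zero_l (u (S k))).
Qed.

Lemma is_series_zero_prefix (a : nat -> X) (k : nat) (l : X) :
  (forall m, (m < k)%nat -> a m = zero) ->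
  is_series (fun m => a (k + m)%nat) l -> is_series a l.
Proof.
  revert a; induction k as [|k IH]; intros a Ha H; [exact H|].
  apply is_series_decr_1.
  assert (E : plus l (opp (a 0%nat)) = l).
  { rewrite (Ha 0%nat) by lia; transitivity (plus l zero); [|exact (plus_zero_r l)].
    f_equal; exact opp_zero. }
  match goal with |- is_series _ ?z => replace z with l by (symmetry; exact E) end.
  apply (IH (fun m => a (S m))); [intros m Hm; apply Ha; lia | exact H].
Qed.

Lemma wsum_point_mul (k : nat) (g : L1) (u : nat -> X) (M : R) :
  bounded_seq M u -> wsum (mul (point k) g) u = wsum g (fun j => u (k + j)%nat).
Proof.
  intros Hu; apply wsum_unique, (is_series_zero_prefix _ k).
  - intros m Hm; rewrite point_mul; destruct (le_dec k m); [lia|].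
    exact (scal_zero_l (u m)).
  - apply is_series_ext with (2 := wsum_is_series g _ M (bounded_seq_shift M u k Hu)).
    intros m; rewrite point_mul; destruct (le_dec k (k + m)); [|lia].
    now replace (k + m - k)%nat with m by lia.
Qed.

(** [f] is the norm-convergent sum of its point masses, so [lsum_tail] controls the remainder. *)
Lemma lsum_points (f : L1) (K : nat) :
  nm (sub f (psum (fun k => scl (f k) (point k)) K)) <= nm f - sum_n (fun k => Rabs (f k)) K.
Proof.
  set (v k := scl (f k) (point k)).
  assert (Hnv : forall k, nm (v k) = Rabs (f k))
    by (intros k; unfold v; rewrite nm_scl, nm_point; ring).
  assert (Hv : ex_series (fun k => nm (v k)))
    by (apply ex_series_ext with (2 := coef_summable f); intros k; now rewrite Hnv).
  replace f with (lsum v Hv) at 1.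
  - apply Rle_trans with (1 := lsum_tail v Hv K), Req_le.
    change (nm f) with (Series (fun k => Rabs (f k))).
    rewrite (Series_ext _ _ Hnv), (sum_n_ext (fun k => nm (v k)) (fun k => Rabs (f k)) K Hnv).
    reflexivity.
  - apply L1_eq; intros n; change (Series (fun k => v k n) = f n).
    apply is_series_unique, lim_sum_is_series.
    apply (is_lim_seq_ext_loc (fun _ => f n)); [|apply is_lim_seq_const].
    exists n; intros N HN; rewrite sum_n_Reals.
    rewrite (sum_eq _ (fun k => seq_point n k * f k)).
    + rewrite sum_point; destruct (le_dec n N); [reflexivity | lia].
    + intros i _; simpl; unfold seq_point.
      destruct (Nat.eq_dec n i); destruct (Nat.eq_dec i n); try lia; try ring.
Qed.

(** Multiplicativity of the calculus, stated without an operator: the inner sum runs over the orbit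
    shifted by [k]. For a point mass the product is such a shift, and finite combinations of point
    masses approximate [f] in norm. *)
Lemma wsum_mul (f g : L1) (u : nat -> X) (M : R) :
  bounded_seq M u ->
  is_series (fun k => scal (RtoC (f k)) (wsum g (fun j => u (k + j)%nat))) (wsum (mul f g) u).
Proof.
  intros Hu.
  set (v k := scl (f k) (point k)).
  assert (E : forall N, wsum (mul (psum v N) g) u =
            sum_n (fun k => scal (RtoC (f k)) (wsum g (fun j => u (k + j)%nat))) N).
  { induction N as [|N IH].
    - rewrite sum_O; simpl psum; unfold v at 1.
      rewrite scl_mul_l, (wsum_scl _ _ u M), (wsum_point_mul _ _ u M) by exact Hu; reflexivity.
    - rewrite sum_Sn, <- IH; change (psum v (S N)) with (add (psum v N) (v (S N))).
      replace (mul (add (psum v N) (v (S N))) g)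
        with (add (mul (psum v N) g) (mul (v (S N)) g)) by ring.
      rewrite (wsum_add _ _ u M) by exact Hu; f_equal; unfold v at 1.
      rewrite scl_mul_l, (wsum_scl _ _ u M), (wsum_point_mul _ _ u M) by exact Hu; reflexivity. }
  apply is_series_of_bound with
    (fun N => M * nm g * (nm f - sum_n (fun k => Rabs (f k)) N)).
  - intros N.
    apply Rle_trans with (norm (wsum (sub (mul (psum v N) g) (mul f g)) u)).
    + apply Req_le; f_equal; transitivity (minus (wsum (mul (psum v N) g) u) (wsum (mul f g) u)).
      * f_equal; symmetry; exact (E N).
      * symmetry; exact (wsum_sub _ _ u M Hu).
    + apply Rle_trans with (1 := norm_wsum _ u M Hu).
      rewrite Rmult_assoc; apply Rmult_le_compat_l; [now apply bounded_seq_ge0 with u|].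
      replace (sub (mul (psum v N) g) (mul f g)) with (opp1 (mul g (sub f (psum v N)))) by ring.
      rewrite nm_opp; apply nm_mul_le; [apply Rle_refl | apply lsum_points].
  - replace (Finite 0) with (Finite (M * nm g * (nm f - nm f))) by (f_equal; ring).
    apply (is_lim_seq_scal_l _ (M * nm g) (Finite (nm f - nm f))).
    apply is_lim_seq_minus'; [apply is_lim_seq_const|].
    apply (sum_n_to_Series (fun k => Rabs (f k))), coef_summable.
Qed.

End Module.

Lemma clinear_sum_n {X : CompleteNormedModule C_AbsRing} (S : X -> X) (a : nat -> X) (N : nat) :
  clinear S -> S (sum_n a N) = sum_n (fun k => S (a k)) N.
Proof.
  intros [Hp _]; induction N as [|N IH]; [now rewrite !sum_O|].
  now rewrite !sum_Sn, Hp, IH.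
Qed.

Lemma clinear_minus {X : CompleteNormedModule C_AbsRing} (S : X -> X) (x y : X) :
  clinear S -> S (minus x y) = minus (S x) (S y).
Proof.
  intros [Hp Hs]; unfold minus; rewrite Hp; f_equal.
  transitivity (S (scal (opp (one : C_AbsRing)) y)); [f_equal; symmetry; exact (scal_opp_one y)|].
  rewrite Hs; exact (scal_opp_one (S y)).
Qed.

Lemma wsum_map {X : CompleteNormedModule C_AbsRing} (S : X -> X) (B M : R)
  (g : L1) (u : nat -> X) :
  clinear S -> (forall x, norm (S x) <= B * norm x) -> bounded_seq M u ->
  S (wsum g u) = wsum g (fun j => S (u j)).
Proof.
  intros HS HB Hu; symmetry; apply wsum_unique.
  assert (HS2 := proj2 HS).
  apply is_series_of_bound with
    (fun N => Rabs B * (norm (minus (sum_n (fun k => scal (RtoC (g k)) (u k)) N) (wsum g u)))).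
  - intros N.
    rewrite (sum_n_ext _ (fun k => S (scal (RtoC (g k)) (u k)))) by (intros; now rewrite HS2).
    rewrite <- clinear_sum_n, <- clinear_minus by exact HS.
    apply Rle_trans with (1 := HB _), Rmult_le_compat_r; [apply norm_ge_0 | apply Rle_abs].
  - replace (Finite 0) with (Finite (Rabs B * 0)) by (f_equal; ring).
    apply (is_lim_seq_scal_l _ (Rabs B) (Finite 0)).
    exact (is_series_norm _ _ (wsum_is_series g u M Hu)).
Qed.

Lemma iter_clinear {X : CompleteNormedModule C_AbsRing} (T : X -> X) (k : nat) :
  clinear T -> clinear (Nat.iter k T).
Proof.
  intros [Hp Hs]; induction k as [|k [IHp IHs]]; split; simpl; intros; auto.
  - now rewrite IHp, Hp.
  - now rewrite IHs, Hs.
Qed.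

(** Each T^k is bounded, so it passes inside the series for F^n; what remains is the product formula
    [wsum_mul]. *)
Lemma iter_Psi {X : CompleteNormedModule C_AbsRing} (T : X -> X) (F : Z -> C) (f : L1) (M : R) :
  (forall k, F (Z.of_nat k) = RtoC (f k)) -> clinear T ->
  (forall n x, norm (Nat.iter n T x) <= M * norm x) ->
  forall n x, Nat.iter n (Psi F T) x = wsum (pw f n) (fun k => Nat.iter k T x).
Proof.
  intros HF HT HM n x; induction n as [|n IH].
  - simpl; now rewrite wsum_one.
  - assert (Hu : bounded_seq (M * norm x) (fun k => Nat.iter k T x)) by (intros k; apply HM).
    simpl Nat.iter; rewrite IH; unfold Psi.
    apply series_lim_eq, is_series_ext with (2 := wsum_mul f (pw f n) _ _ Hu).
    intros k; rewrite HF; f_equal.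
    rewrite (wsum_map (Nat.iter k T) M (M * norm x)); auto using iter_clinear.
    apply wsum_ext; intros j; apply Nat.iter_add.
Qed.

Lemma ritt_Psi {X : CompleteNormedModule C_AbsRing} (T : X -> X) (F : Z -> C) (f : L1) :
  (forall k, F (Z.of_nat k) = RtoC (f k)) -> nm f <= 1 ->
  (exists B, forall n, INR n * nm (mul (pw f n) (sub one1 f)) <= B) ->
  clinear T -> power_bounded (fun _ => True) norm T ->
  ritt (fun _ => True) norm minus (Psi F T).
Proof.
  intros HF Hf [B HB] HT [M0 HM0].
  (* On the zero space the given bound may be negative, hence the absolute value. *)
  set (M1 := Rabs M0).
  assert (HM : forall n x, norm (Nat.iter n T x) <= M1 * norm x).
  { intros n x; apply Rle_trans with (1 := HM0 n x I), Rmult_le_compat_r;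
      [apply norm_ge_0 | apply Rle_abs]. }
  assert (HM1 : 0 <= M1) by apply Rabs_pos.
  assert (Hit := iter_Psi T F f M1 HF HT HM).
  assert (Hu : forall x, bounded_seq (M1 * norm x) (fun k => Nat.iter k T x))
    by (intros x k; apply HM).
  split.
  - exists M1; intros n x _; rewrite Hit.
    apply Rle_trans with (1 := norm_wsum _ _ _ (Hu x)).
    rewrite <- (Rmult_1_r (M1 * norm x)) at 2.
    apply Rmult_le_compat_l; [apply Rmult_le_pos; auto using norm_ge_0 | now apply nm_pw_le1].
  - exists (M1 * B); intros n x _; rewrite !Hit, <- (wsum_sub _ _ _ _ (Hu x)).
    apply Rle_trans with (INR n * (M1 * norm x * nm (mul (pw f n) (sub one1 f)))).
    + apply Rmult_le_compat_l; [apply pos_INR|].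
      replace (mul (pw f n) (sub one1 f)) with (sub (pw f n) (pw f (S n))) by (simpl; ring).
      exact (norm_wsum _ _ _ (Hu x)).
    + assert (Hx := norm_ge_0 x).
      assert (0 <= M1 * norm x) by now apply Rmult_le_pos.
      generalize (HB n); intros; nra.
Qed.

(** * Real sequences as functions on the integers *)

Definition emb (a : nat -> R) : Z -> C :=
  fun z => if Z_lt_dec z 0 then RtoC 0 else RtoC (a (Z.to_nat z)).

Lemma emb_nat (a : nat -> R) (k : nat) : emb a (Z.of_nat k) = RtoC (a k).
Proof. unfold emb; destruct (Z_lt_dec _ _); [lia | now rewrite Nat2Z.id]. Qed.

Lemma emb_neg (a : nat -> R) (z : Z) : (z < 0)%Z -> emb a z = RtoC 0.
Proof. intros Hz; unfold emb; destruct (Z_lt_dec _ _); [reflexivity | lia]. Qed.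

Lemma neg_idx_neg (k : nat) : (neg_idx k < 0)%Z.
Proof. unfold neg_idx; lia. Qed.

Lemma emb_ext (u : Z -> C) (a : nat -> R) :
  (forall k, u (Z.of_nat k) = RtoC (a k)) -> (forall z, (z < 0)%Z -> u z = RtoC 0) -> u = emb a.
Proof.
  intros Hp Hn; apply functional_extensionality; intros z.
  unfold emb; destruct (Z_lt_dec z 0) as [Hz|Hz]; [now apply Hn|].
  rewrite <- Hp; f_equal; lia.
Qed.

Lemma is_series_pair (a b : nat -> R) (la lb : R) :
  is_series a la -> is_series b lb ->
  is_series (V := C_NormedModule) (fun k => (a k, b k) : C) ((la, lb) : C).
Proof.
  intros Ha Hb.
  assert (E : forall N, sum_n (G := C_AbelianMonoid) (fun k => (a k, b k) : C) N
                        = (sum_n a N, sum_n b N)).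
  { induction N as [|N IH]; [now rewrite !sum_O|].
    now rewrite !sum_Sn, IH. }
  apply filterlim_locally; intros eps.
  destruct (proj1 (filterlim_locally _ _) Ha eps) as [Na HNa].
  destruct (proj1 (filterlim_locally _ _) Hb eps) as [Nb HNb].
  exists (Na + Nb)%nat; intros n Hn.
  change (ball ((la, lb) : C) eps (sum_n (G := C_AbelianMonoid) (fun k => (a k, b k) : C) n)).
  rewrite E; split; [apply HNa | apply HNb]; lia.
Qed.

Lemma is_series_RtoC (a : nat -> R) (l : R) :
  is_series a l -> is_series (V := C_NormedModule) (fun k => RtoC (a k)) (RtoC l).
Proof.
  intros Ha; apply (is_series_pair a (fun _ => 0) l 0 Ha), lim_sum_is_series.
  apply (is_lim_seq_ext (fun _ => 0)); [|apply is_lim_seq_const].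
  intros N; induction N as [|N IH]; [now rewrite sum_O|].
  rewrite sum_Sn, <- IH; unfold plus; simpl; ring.
Qed.

Lemma is_series_C_zero : is_series (V := C_NormedModule) (fun _ : nat => RtoC 0) (RtoC 0).
Proof.
  exact (is_series_one_term (X := C_CompleteNormedModule) (fun _ => RtoC 0) 0
           (fun _ _ => eq_refl)).
Qed.

Lemma zsum_nonneg_support (u : Z -> C) (l : C) :
  (forall z, (z < 0)%Z -> u z = RtoC 0) ->
  is_series (V := C_NormedModule) (fun k => u (Z.of_nat k)) l -> zsum u = l.
Proof.
  intros Hn Hl; unfold zsum.
  rewrite (series_lim_eq (V := C_CompleteNormedModule) _ l Hl).
  rewrite (series_lim_eq (V := C_CompleteNormedModule) (fun n => u (neg_idx n)) (RtoC 0)).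
  - apply Cplus_0_r.
  - apply is_series_ext with (2 := is_series_C_zero).
    intros k; symmetry; apply Hn, neg_idx_neg.
Qed.

Lemma l1norm_emb (a : nat -> R) : l1norm (emb a) = Series (fun n => Rabs (a n)).
Proof.
  apply Series_ext; intros n.
  rewrite emb_nat, emb_neg, !Cmod_R, Rabs_R0 by apply neg_idx_neg; ring.
Qed.

(** The passage to the real algebra: for nonnegative [f] the norm is the sum, so total mass 1
    becomes norm 1. *)
Lemma PZplus_emb (F : Z -> C) :
  PZplus F -> exists f : L1, F = emb f /\ nonneg_seq f /\ nm f = 1.
Proof.
  intros (Hre & Hsum & Hmass & Hneg).
  assert (HF : forall k, F (Z.of_nat k) = RtoC (Re (F (Z.of_nat k)))).
  { intros k; destruct (Hre (Z.of_nat k)) as [_ Him].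
    destruct (F (Z.of_nat k)) as [x y]; simpl in *; now rewrite Him. }
  assert (Hf : ex_series (fun n => Rabs (Re (F (Z.of_nat n))))).
  { apply @ex_series_le with (2 := Hsum); intros n.
    unfold norm; simpl; unfold abs; simpl; rewrite Rabs_Rabsolu.
    rewrite <- Cmod_R, <- HF; generalize (Cmod_ge_0 (F (neg_idx n))); lra. }
  set (f := mkL1 (fun n => Re (F (Z.of_nat n))) Hf).
  assert (Hff : nonneg_seq f) by (intros n; apply Hre).
  exists f; split; [|split; [exact Hff|]].
  - now apply emb_ext.
  - rewrite nm_nonneg by exact Hff.
    assert (E : zsum F = RtoC (Series f)).
    { apply zsum_nonneg_support; [exact Hneg|].
      apply is_series_ext with (fun k => RtoC (f k)); [intros k; now rewrite HF|].
      apply is_series_RtoC, Series_correct, nonneg_ex_series. }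
    rewrite Hmass in E; symmetry; now apply RtoC_inj.
Qed.

Lemma conv_emb_l (f : L1) (H : Z -> C) :
  conv (emb f) H =
  fun z => wsum (X := C_CompleteNormedModule) f (fun k => H (z - Z.of_nat k)%Z).
Proof.
  apply functional_extensionality; intros z.
  unfold conv, zsum, wsum.
  rewrite (series_lim_eq (V := C_CompleteNormedModule)
             (fun n => emb f (neg_idx n) * H (z - neg_idx n)%Z)%C (RtoC 0)).
  - rewrite Cplus_0_r; f_equal; apply functional_extensionality; intros k.
    now rewrite emb_nat.
  - apply is_series_ext with (2 := is_series_C_zero).
    intros k; rewrite emb_neg by apply neg_idx_neg; symmetry; apply Cmult_0_l.
Qed.

Lemma is_series_finite (a : nat -> R) (n : nat) :
  (forall k, (n < k)%nat -> a k = 0) -> is_series a (sum_n a n).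
Proof.
  intros H; apply lim_sum_is_series.
  apply (is_lim_seq_ext_loc (fun _ => sum_n a n)); [|apply is_lim_seq_const].
  exists n; intros N HN; induction HN as [|N HN IH]; [reflexivity|].
  rewrite sum_Sn, <- IH, (H (S N)) by lia; symmetry; apply (Rplus_0_r (sum_n a n)).
Qed.

Lemma conv_emb (a b : L1) : conv (emb a) (emb b) = emb (mul a b).
Proof.
  rewrite conv_emb_l; apply emb_ext.
  - intros n; apply wsum_unique.
    apply is_series_ext with
      (fun k => RtoC (a k * (if le_dec k n then b (n - k)%nat else 0))).
    + intros k; rewrite RtoC_mult; unfold scal; simpl; unfold mult; simpl; f_equal.
      destruct (le_dec k n).
      * rewrite <- Nat2Z.inj_sub by lia; symmetry; apply emb_nat.
      * symmetry; apply emb_neg; lia.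
    + apply is_series_RtoC.
      replace (mul a b n)
        with (sum_n (fun k => a k * (if le_dec k n then b (n - k)%nat else 0)) n).
      * apply is_series_finite; intros k Hk; destruct (le_dec k n); [lia | ring].
      * rewrite sum_n_Reals; apply sum_eq; intros k Hk; destruct (le_dec k n); [ring | lia].
  - intros z Hz; apply wsum_unique, is_series_ext with (2 := is_series_C_zero).
    intros k; rewrite emb_neg by lia; symmetry; apply Cmult_0_r.
Qed.

Lemma delta0_emb : delta0 = emb one1.
Proof.
  apply emb_ext; intros k; unfold delta0; destruct (Z.eq_dec _ 0).
  - replace k with 0%nat by lia; reflexivity.
  - destruct k; [lia | reflexivity].
  - lia.
  - reflexivity.
Qed.

Lemma convpow_emb (a : L1) (n : nat) : convpow (emb a) n = emb (pw a n).
Proof.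
  induction n as [|n IH]; simpl; [apply delta0_emb | rewrite IH; apply conv_emb].
Qed.

Lemma lsub_emb (a b : L1) : lsub (emb a) (emb b) = emb (sub a b).
Proof.
  apply emb_ext; unfold lsub.
  - intros k; rewrite !emb_nat, <- RtoC_minus; f_equal; simpl; ring.
  - intros z Hz; rewrite !emb_neg by exact Hz; rewrite <- RtoC_minus; f_equal; ring.
Qed.

Lemma lscal_emb (c : R) (a : L1) : lscal (RtoC c) (emb a) = emb (scl c a).
Proof.
  apply emb_ext; unfold lscal.
  - intros k; now rewrite emb_nat, <- RtoC_mult.
  - intros z Hz; rewrite emb_neg by exact Hz; apply Cmult_0_r.
Qed.

Lemma lexp_emb (a : L1) : lexp (emb a) = emb (ex1 a).
Proof.
  apply emb_ext; unfold lexp.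
  - intros n; apply (series_lim_eq (V := C_CompleteNormedModule)).
    apply is_series_ext with (fun k => RtoC (scl (/ INR (fact k)) (pw a k) n)).
    + intros k; rewrite convpow_emb, emb_nat; apply RtoC_mult.
    + apply is_series_RtoC, Series_correct.
      apply ex_series_Rabs, (lsum_pointwise _ (ex1_summable a)).
  - intros z Hz; apply (series_lim_eq (V := C_CompleteNormedModule)).
    apply is_series_ext with (2 := is_series_C_zero).
    intros k; rewrite convpow_emb, emb_neg by exact Hz; symmetry; apply Cmult_0_r.
Qed.

Lemma l1norm_heat (f : L1) (t : R) :
  l1norm (conv (lsub delta0 (emb f)) (lexp (lscal (RtoC (- t)) (lsub delta0 (emb f)))))
  = nm (mul (sub one1 f) (ex1 (scl (- t) (sub one1 f)))).
Proof. now rewrite delta0_emb, lsub_emb, lscal_emb, lexp_emb, conv_emb, l1norm_emb. Qed.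

Lemma classA_emb (f : L1) : PZplus (emb f) ->
  (classA (emb f) <-> exists M, forall n, INR n * nm (mul (pw f n) (sub one1 f)) <= M).
Proof.
  intros HF.
  assert (E : forall n, l1norm (lsub (convpow (emb f) n) (convpow (emb f) (S n)))
                        = nm (mul (pw f n) (sub one1 f))).
  { intros n; rewrite !convpow_emb, lsub_emb, l1norm_emb.
    replace (mul (pw f n) (sub one1 f)) with (sub (pw f n) (pw f (S n))) by (simpl; ring).
    reflexivity. }
  split.
  - intros [_ [M HM]]; exists M; intros n; rewrite <- E; apply HM.
  - intros [M HM]; split; [exact HF|]; exists M; intros n; rewrite E; apply HM.
Qed.

(** * The convolution operator on [L^1(Z)] *)

(** The shift moves the value at -1 from the head of the negative half to the head of the
    nonnegative one. The norm is a single series of paired terms, so the halves are separated before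
    the move. *)
Lemma summable_shift1 (H : Z -> C) : summable H ->
  summable (fun z => H (z - 1)%Z) /\ l1norm (fun z => H (z - 1)%Z) = l1norm H.
Proof.
  intros HH.
  set (p i := Cmod (H (Z.of_nat i))); set (q i := Cmod (H (neg_idx i))).
  assert (Hp0 : forall i, 0 <= p i) by (intros; apply Cmod_ge_0).
  assert (Hq0 : forall i, 0 <= q i) by (intros; apply Cmod_ge_0).
  assert (Hp : ex_series p).
  { apply @ex_series_le with (2 := HH); intros n; unfold norm; simpl; unfold abs; simpl.
    rewrite Rabs_pos_eq by apply Hp0; generalize (Hq0 n); unfold p, q; lra. }
  assert (Hq : ex_series q).
  { apply @ex_series_le with (2 := HH); intros n; unfold norm; simpl; unfold abs; simpl.
    rewrite Rabs_pos_eq by apply Hq0; generalize (Hp0 n); unfold p, q; lra. }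
  set (p' i := Cmod (H (Z.of_nat i - 1)%Z)); set (q' i := Cmod (H (neg_idx i - 1)%Z)).
  assert (Ep0 : p' 0%nat = q 0%nat) by reflexivity.
  assert (Ep : forall i, p' (S i) = p i) by (intros i; unfold p', p; do 2 f_equal; lia).
  assert (Eq : forall i, q' i = q (S i)) by (intros i; unfold q', q, neg_idx; do 2 f_equal; lia).
  assert (Hp' : ex_series p').
  { apply ex_series_incr_1; now apply ex_series_ext with (2 := Hp). }
  assert (Hq' : ex_series q').
  { apply ex_series_ext with (fun i => q (S i)); [intros; now symmetry|].
    now apply (ex_series_incr_1 q). }
  split; [exact (ex_series_plus (V := R_NormedModule) p' q' Hp' Hq')|].
  unfold l1norm; change (Series (fun i => p' i + q' i) = Series (fun i => p i + q i)).
  rewrite !Series_plus by assumption.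
  rewrite (Series_incr_1 p' Hp'), (Series_incr_1 q Hq), Ep0, (Series_ext _ _ Ep), (Series_ext _ _ Eq).
  ring.
Qed.

Lemma summable_shift (H : Z -> C) (k : nat) : summable H ->
  summable (fun z => H (z - Z.of_nat k)%Z) /\ l1norm (fun z => H (z - Z.of_nat k)%Z) = l1norm H.
Proof.
  intros HH; induction k as [|k [IHs IHn]].
  - replace (fun z => H (z - Z.of_nat 0)%Z) with H; [now split|].
    apply functional_extensionality; intros z; f_equal; lia.
  - replace (fun z => H (z - Z.of_nat (S k))%Z)
      with (fun z => (fun z' => H (z' - Z.of_nat k)%Z) (z - 1)%Z).
    + rewrite <- IHn; exact (summable_shift1 _ IHs).
    + apply functional_extensionality; intros z; f_equal; lia.
Qed.

Lemma habs_nonneg (H : Z -> C) (i : nat) :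
  0 <= Cmod (H (Z.of_nat i)) + Cmod (H (neg_idx i)).
Proof. apply Rplus_le_le_0_compat; apply Cmod_ge_0. Qed.

Lemma l1norm_ge0 (H : Z -> C) : summable H -> 0 <= l1norm H.
Proof. intros HH; apply Series_nonneg; [apply habs_nonneg | exact HH]. Qed.

Lemma Cmod_le_l1norm (H : Z -> C) (z : Z) : summable H -> Cmod (H z) <= l1norm H.
Proof.
  intros HH; destruct (Z.lt_ge_cases z 0) as [Hz|Hz].
  - assert (Hi := term_le_Series _ (Z.to_nat (- z - 1)) (habs_nonneg H) HH); simpl in Hi.
    replace (neg_idx (Z.to_nat (- z - 1))) with z in Hi by (unfold neg_idx; lia).
    generalize (Cmod_ge_0 (H (Z.of_nat (Z.to_nat (- z - 1))))); unfold l1norm; lra.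
  - assert (Hi := term_le_Series _ (Z.to_nat z) (habs_nonneg H) HH); simpl in Hi.
    rewrite Z2Nat.id in Hi by lia.
    generalize (Cmod_ge_0 (H (neg_idx (Z.to_nat z)))); unfold l1norm; lra.
Qed.

Lemma bounded_orbit (H : Z -> C) (z : Z) : summable H ->
  bounded_seq (X := C_CompleteNormedModule) (l1norm H) (fun k => H (z - Z.of_nat k)%Z).
Proof. intros HH k; exact (Cmod_le_l1norm H _ HH). Qed.

Lemma Cmod_wsum (g : L1) (u : nat -> C) (M : R) :
  bounded_seq (X := C_CompleteNormedModule) M u ->
  ex_series (fun k => Rabs (g k) * Cmod (u k)) /\
  Cmod (wsum (X := C_CompleteNormedModule) g u) <= Series (fun k => Rabs (g k) * Cmod (u k)).
Proof.
  intros Hu.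
  assert (Hex : ex_series (fun k => Rabs (g k) * Cmod (u k))).
  { apply @ex_series_le with (fun k => Rabs (g k) * M).
    - intros k; unfold norm; simpl; unfold abs; simpl.
      rewrite Rabs_pos_eq by (apply Rmult_le_pos; [apply Rabs_pos | apply Cmod_ge_0]).
      apply Rmult_le_compat_l; [apply Rabs_pos | apply (Hu k)].
    - apply ex_series_ext with (fun k => M * Rabs (g k)); [intros; apply Rmult_comm|].
      apply @ex_series_scal with (V := R_NormedModule); apply coef_summable. }
  split; [exact Hex|].
  apply (norm_series_le (X := C_CompleteNormedModule) _ _ _
           (wsum_is_series (X := C_CompleteNormedModule) g u M Hu)).
  intros N.
  apply Rle_trans with
    (1 := norm_sum_n_m (V := C_NormedModule) (fun k => scal (RtoC (g k)) (u k)) 0 N).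
  apply Rle_trans with (sum_n (fun k => Rabs (g k) * Cmod (u k)) N).
  - apply (sum_n_mono (fun k => norm (V := C_NormedModule) (scal (RtoC (g k)) (u k)))).
    intros k; exact (norm_scal_R (X := C_CompleteNormedModule) (g k) (u k)).
  - apply sum_n_le_Series; [|exact Hex].
    intros k; apply Rmult_le_pos; [apply Rabs_pos | apply Cmod_ge_0].
Qed.

(** A partial sum of the norm of [G] is exchanged with the series over [k]; there each translate of
    [H] contributes at most [l1norm H]. *)
Lemma young_L1 (g : L1) (H : Z -> C) : summable H ->
  let G := fun z => wsum (X := C_CompleteNormedModule) g (fun k => H (z - Z.of_nat k)%Z) in
  l1norm G <= nm g * l1norm H.
Proof.
  intros HH G.
  set (h k i := Cmod (H (Z.of_nat i - Z.of_nat k)%Z) + Cmod (H (neg_idx i - Z.of_nat k)%Z)).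
  assert (Hv : forall i, ex_series (fun k => Rabs (g k) * h k i) /\
             Cmod (G (Z.of_nat i)) + Cmod (G (neg_idx i)) <= Series (fun k => Rabs (g k) * h k i)).
  { intros i.
    destruct (Cmod_wsum g _ _ (bounded_orbit H (Z.of_nat i) HH)) as [E1 B1].
    destruct (Cmod_wsum g _ _ (bounded_orbit H (neg_idx i) HH)) as [E2 B2].
    assert (E : forall k, Rabs (g k) * Cmod (H (Z.of_nat i - Z.of_nat k)%Z) +
                          Rabs (g k) * Cmod (H (neg_idx i - Z.of_nat k)%Z) = Rabs (g k) * h k i)
      by (intros k; unfold h; ring).
    split.
    - apply ex_series_ext with (1 := E).
      exact (ex_series_plus (V := R_NormedModule) _ _ E1 E2).
    - rewrite <- (Series_ext _ _ E), Series_plus by assumption.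
      now apply Rplus_le_compat. }
  apply ex_series_bounded; [apply habs_nonneg|].
  intros N.
  apply Rle_trans with (sum_n (fun i => Series (fun k => Rabs (g k) * h k i)) N).
  { apply sum_n_mono; intros i; apply Hv. }
  rewrite <- (is_series_unique _ _
     (is_series_sum_n (fun k i => Rabs (g k) * h k i) N (fun i => proj1 (Hv i)))).
  replace (nm g * l1norm H) with (Series (fun k => Rabs (g k) * l1norm H)) by apply Series_scal_r.
  apply Series_le.
  - intros k.
    rewrite sum_n_scal_R.
    destruct (summable_shift H k HH) as [Hs <-].
    split.
    + apply Rmult_le_pos; [apply Rabs_pos|].
      apply sum_n_nonneg; intros i; unfold h; apply Rplus_le_le_0_compat; apply Cmod_ge_0.
    + apply Rmult_le_compat_l; [apply Rabs_pos|].
      apply (sum_n_le_Series _ N (habs_nonneg (fun z => H (z - Z.of_nat k)%Z)) Hs).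
  - apply ex_series_ext with (fun k => l1norm H * Rabs (g k)); [intros; apply Rmult_comm|].
    apply @ex_series_scal with (V := R_NormedModule); apply coef_summable.
Qed.

Lemma iter_conv (f : L1) (H : Z -> C) (n : nat) : summable H ->
  Nat.iter n (conv (emb f)) H =
  fun z => wsum (X := C_CompleteNormedModule) (pw f n) (fun k => H (z - Z.of_nat k)%Z).
Proof.
  intros HH; induction n as [|n IH].
  - apply functional_extensionality; intros z; simpl.
    rewrite wsum_one; f_equal; lia.
  - simpl Nat.iter; rewrite IH, conv_emb_l; apply functional_extensionality; intros z.
    apply wsum_unique.
    apply is_series_ext with
      (2 := wsum_mul (X := C_CompleteNormedModule) f (pw f n) _ _ (bounded_orbit H z HH)).
    intros k; f_equal; apply wsum_ext; intros j; f_equal; lia.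
Qed.

Lemma ritt_conv (f : L1) : nm f <= 1 ->
  (exists B, forall n, INR n * nm (mul (pw f n) (sub one1 f)) <= B) ->
  ritt summable l1norm lsub (conv (emb f)).
Proof.
  intros Hf [B HB]; split.
  - exists 1; intros n H HH; rewrite iter_conv by exact HH.
    apply Rle_trans with (1 := young_L1 (pw f n) H HH).
    apply Rmult_le_compat_r; [now apply l1norm_ge0 | now apply nm_pw_le1].
  - exists B; intros n H HH; rewrite !iter_conv by exact HH.
    replace (lsub _ _) with (fun z => wsum (X := C_CompleteNormedModule)
       (mul (pw f n) (sub one1 f)) (fun k => H (z - Z.of_nat k)%Z)).
    + apply Rle_trans with (INR n * (nm (mul (pw f n) (sub one1 f)) * l1norm H)).
      * apply Rmult_le_compat_l; [apply pos_INR | now apply young_L1].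
      * rewrite <- Rmult_assoc; apply Rmult_le_compat_r; [now apply l1norm_ge0 | apply HB].
    + apply functional_extensionality; intros z.
      replace (mul (pw f n) (sub one1 f)) with (sub (pw f n) (pw f (S n))) by (simpl; ring).
      exact (wsum_sub _ _ _ _ (bounded_orbit H z HH)).
Qed.

(** The bound is tested on the unit [delta0], whose orbit consists of the convolution powers of
    [F]. *)
Lemma ritt_conv_classA (F : Z -> C) :
  PZplus F -> ritt summable l1norm lsub (conv F) -> classA F.
Proof.
  intros HF [_ [M HM]]; split; [exact HF|].
  assert (Hd : summable delta0).
  { apply ex_series_ext with (fun n => Rabs (one1 n)); [|apply coef_summable].
    intros n; rewrite delta0_emb, emb_nat, emb_neg, !Cmod_R, Rabs_R0 by apply neg_idx_neg.
    symmetry; apply Rplus_0_r. }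
  assert (Hit : forall n, Nat.iter n (conv F) delta0 = convpow F n)
    by (induction n as [|n IH]; simpl; [|rewrite IH]; reflexivity).
  exists (M * l1norm delta0); intros n; rewrite <- !Hit; now apply HM.
Qed.

(** * The Banach space of bounded sequences *)

(** The complex space l^infinity, dual to l^1: every real summable sequence has an explicit norming
    vector there, its sequence of signs. *)
Record bseq : Type := mkbseq {
  bval :> nat -> C;
  bval_bounded : exists M, forall n, Cmod (bval n) <= M }.

Lemma bseq_eq (x y : bseq) : (forall n, x n = y n) -> x = y.
Proof.
  destruct x as [x Hx], y as [y Hy]; simpl; intros H.
  assert (E : x = y) by (apply functional_extensionality; exact H).
  subst y; f_equal; apply proof_irrelevance.
Qed.

Definition bzero : bseq.
Proof. exists (fun _ => RtoC 0); exists 0; intros n; rewrite Cmod_0; apply Rle_refl. Defined.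

Definition badd (x y : bseq) : bseq.
Proof.
  exists (fun n => Cplus (x n) (y n)).
  destruct (bval_bounded x) as [M HM], (bval_bounded y) as [N HN].
  exists (M + N); intros n.
  apply Rle_trans with (1 := Cmod_triangle _ _); now apply Rplus_le_compat.
Defined.

Definition bscal (c : C) (x : bseq) : bseq.
Proof.
  exists (fun n => Cmult c (x n)).
  destruct (bval_bounded x) as [M HM].
  exists (Cmod c * M); intros n; rewrite Cmod_mult.
  apply Rmult_le_compat_l; [apply Cmod_ge_0 | apply HM].
Defined.

Definition bopp (x : bseq) : bseq.
Proof.
  exists (fun n => Copp (x n)).
  destruct (bval_bounded x) as [M HM].
  exists M; intros n; rewrite Cmod_opp; apply HM.
Defined.

Definition bnorm (x : bseq) : R := real (Lub_Rbar (fun r => exists n, r = Cmod (x n))).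

Lemma bnorm_lub (x : bseq) :
  (forall n, Cmod (x n) <= bnorm x) /\
  (forall B, (forall n, Cmod (x n) <= B) -> bnorm x <= B).
Proof.
  destruct (bval_bounded x) as [M HM].
  destruct (Lub_Rbar_correct (fun r => exists n, r = Cmod (x n))) as [Hub Hlub].
  assert (HM' := Hlub (Finite M) ltac:(intros r [n ->]; apply HM)).
  assert (H0 := Hub _ (ex_intro _ 0%nat eq_refl)).
  unfold bnorm; destruct (Lub_Rbar _) as [l| |]; simpl in *; try contradiction.
  split.
  - intros n; exact (Hub _ (ex_intro _ n eq_refl)).
  - intros B HB; apply (Hlub (Finite B)); intros r [n ->]; apply HB.
Qed.

Lemma Cmod_le_bnorm (x : bseq) (n : nat) : Cmod (x n) <= bnorm x.
Proof. apply bnorm_lub. Qed.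

Lemma bnorm_le (x : bseq) (B : R) : (forall n, Cmod (x n) <= B) -> bnorm x <= B.
Proof. apply bnorm_lub. Qed.

Lemma bnorm_add (x y : bseq) : bnorm (badd x y) <= bnorm x + bnorm y.
Proof.
  apply bnorm_le; intros n; apply Rle_trans with (1 := Cmod_triangle _ _).
  apply Rplus_le_compat; apply Cmod_le_bnorm.
Qed.

Lemma bnorm_scal (c : C) (x : bseq) : bnorm (bscal c x) <= Cmod c * bnorm x.
Proof.
  apply bnorm_le; intros n; simpl; rewrite Cmod_mult.
  apply Rmult_le_compat_l; [apply Cmod_ge_0 | apply Cmod_le_bnorm].
Qed.

Lemma bnorm_zero (x : bseq) : bnorm x = 0 -> x = bzero.
Proof.
  intros H; apply bseq_eq; intros n; apply Cmod_eq_0.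
  apply Rle_antisym; [rewrite <- H; apply Cmod_le_bnorm | apply Cmod_ge_0].
Qed.

Definition bdist (x y : bseq) : R := bnorm (badd y (bopp x)).

Lemma bdist_refl (x : bseq) : bdist x x = 0.
Proof.
  apply Rle_antisym.
  - apply bnorm_le; intros n; simpl; rewrite Cplus_opp_r, Cmod_0; apply Rle_refl.
  - apply Rle_trans with (2 := Cmod_le_bnorm _ 0%nat), Cmod_ge_0.
Qed.

Lemma bdist_sym (x y : bseq) : bdist x y <= bdist y x.
Proof.
  apply bnorm_le; intros n; simpl.
  replace (y n + - x n)%C with (- (x n + - y n))%C by ring.
  rewrite Cmod_opp; apply (Cmod_le_bnorm (badd x (bopp y)) n).
Qed.

Lemma bdist_triangle (x y z : bseq) : bdist x z <= bdist x y + bdist y z.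
Proof.
  apply bnorm_le; intros n; simpl.
  replace (z n + - x n)%C with ((y n + - x n) + (z n + - y n))%C by ring.
  apply Rle_trans with (1 := Cmod_triangle _ _); apply Rplus_le_compat.
  - apply (Cmod_le_bnorm (badd y (bopp x)) n).
  - apply (Cmod_le_bnorm (badd z (bopp y)) n).
Qed.

Definition bball (x : bseq) (e : R) (y : bseq) : Prop := bdist x y < e.

Lemma bball_center (x : bseq) (e : posreal) : bball x e x.
Proof. unfold bball; rewrite bdist_refl; apply cond_pos. Qed.

Lemma bball_sym (x y : bseq) (e : R) : bball x e y -> bball y e x.
Proof. unfold bball; generalize (bdist_sym y x); lra. Qed.

Lemma bball_triangle (x y z : bseq) (e1 e2 : R) :
  bball x e1 y -> bball y e2 z -> bball x (e1 + e2) z.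
Proof. unfold bball; generalize (bdist_triangle x y z); lra. Qed.

Definition bseq_AbelianMonoid_mixin : AbelianMonoid.mixin_of bseq.
Proof.
  apply (AbelianMonoid.Mixin bseq badd bzero); intros; apply bseq_eq; intros n; simpl; ring.
Defined.

Definition bseq_AbelianMonoid := AbelianMonoid.Pack bseq bseq_AbelianMonoid_mixin bseq.

Definition bseq_AbelianGroup_mixin : AbelianGroup.mixin_of bseq_AbelianMonoid.
Proof.
  apply (AbelianGroup.Mixin bseq_AbelianMonoid bopp); intros; apply bseq_eq; intros n.
  apply Cplus_opp_r.
Defined.

Definition bseq_AbelianGroup :=
  AbelianGroup.Pack bseq (AbelianGroup.Class _ _ bseq_AbelianGroup_mixin) bseq.

Definition bseq_ModuleSpace_mixin : ModuleSpace.mixin_of C_AbsRing bseq_AbelianGroup.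
Proof.
  apply (ModuleSpace.Mixin C_AbsRing bseq_AbelianGroup bscal); intros; apply bseq_eq; intros n.
  - apply Cmult_assoc.
  - apply Cmult_1_l.
  - apply Cmult_plus_distr_l.
  - apply Cmult_plus_distr_r.
Defined.

Definition bseq_UniformSpace_mixin : UniformSpace.mixin_of bseq :=
  UniformSpace.Mixin bseq bzero bball bball_center bball_sym bball_triangle.

Definition bseq_UniformSpace := UniformSpace.Pack bseq bseq_UniformSpace_mixin bseq.

Definition bseq_NormedModuleAux : NormedModuleAux C_AbsRing :=
  NormedModuleAux.Pack C_AbsRing bseq
    (NormedModuleAux.Class _ _ (ModuleSpace.Class _ _ _ bseq_ModuleSpace_mixin)
       bseq_UniformSpace_mixin) bseq.

Lemma bseq_compat (x y : bseq) (eps : posreal) : bball x eps y -> bdist x y < 1 * eps.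
Proof. unfold bball; lra. Qed.

Definition bseq_NormedModule_mixin : NormedModule.mixin_of C_AbsRing bseq_NormedModuleAux :=
  NormedModule.Mixin C_AbsRing bseq_NormedModuleAux bnorm 1
    bnorm_add bnorm_scal (fun _ _ _ H => H) bseq_compat bnorm_zero.

Definition is_blim (F : (bseq -> Prop) -> Prop) (l : bseq) : Prop :=
  forall eps : posreal, F (bball l eps).

(** A complete space carries a limit function defined on all filters, so a limit is chosen when one
    exists; on other filters the value is arbitrary. *)
Definition blim (F : (bseq -> Prop) -> Prop) : bseq := epsilon (inhabits bzero) (is_blim F).

(** The candidate is the coordinatewise limit. A ball of [F] around x is uniform in the coordinate,
    so the candidate stays uniformly close to x; this gives both its boundedness and convergence. *)
Lemma bseq_complete (F : (bseq -> Prop) -> Prop) :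
  ProperFilter F -> cauchy (T := bseq_UniformSpace) F -> is_blim F (blim F).
Proof.
  intros FF FC; apply (epsilon_spec (inhabits bzero) (is_blim F)).
  (* The balls of [C] are products of intervals and agree with discs for the modulus only up to this
     factor. *)
  set (kappa := norm_factor (K := C_AbsRing) (V := C_NormedModule)).
  assert (Hk : 0 < kappa) by apply norm_factor_gt_0.
  set (Fn n := filtermap (fun x : bseq => x n) F).
  assert (FFn : forall n, ProperFilter (Fn n)) by (intros; now apply filtermap_proper_filter).
  assert (FCn : forall n, cauchy (T := C_UniformSpace) (Fn n)).
  { intros n e; destruct (FC e) as [x Hx]; exists (x n).
    apply (filter_imp (F := F) (bball x e)); [|exact Hx].
    intros y Hy; apply (norm_compat1 (V := C_NormedModule)).
    apply Rle_lt_trans with (2 := Hy).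
    exact (Cmod_le_bnorm (badd y (bopp x)) n). }
  set (l n := lim (T := C_CompleteNormedModule) (Fn n) : C).
  (* A point y of the filter set is within [d] of x and has n-th coordinate within [d] of the limit;
     y depends on n, the bound does not. *)
  assert (Hl : forall (x : bseq) (d : posreal), F (bball x d) -> forall n, Cmod (l n - x n) <= d + d).
  { intros x d Hx n.
    assert (Hdk : 0 < d / kappa) by (apply Rdiv_lt_0_compat; [apply cond_pos | exact Hk]).
    assert (Hln := complete_cauchy (T := C_CompleteNormedModule) (Fn n) (FFn n) (FCn n) (mkposreal _ Hdk)).
    destruct (filter_ex (F := F) _ (filter_and (F := F)
      (fun y => ball (M := C_UniformSpace) (l n) (mkposreal _ Hdk) (y n)) (bball x d) Hln Hx))
      as [y [Hy1 Hy2]].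
    apply (norm_compat2 (V := C_NormedModule)) in Hy1; simpl in Hy1; fold kappa in Hy1.
    replace (kappa * (d / kappa)) with (pos d) in Hy1 by (field; lra).
    change (Cmod (y n - l n) < d) in Hy1.
    assert (Hy3 : Cmod (y n - x n) < d).
    { apply Rle_lt_trans with (2 := Hy2); exact (Cmod_le_bnorm (badd y (bopp x)) n). }
    replace (l n - x n)%C with (- (y n - l n) + (y n - x n))%C by ring.
    apply Rle_trans with (1 := Cmod_triangle _ _); rewrite Cmod_opp; lra. }
  assert (Hlb : exists M, forall n, Cmod (l n) <= M).
  { destruct (FC (mkposreal 1 Rlt_0_1)) as [x Hx].
    exists (bnorm x + 2); intros n.
    replace (l n) with (x n + (l n - x n))%C by ring.
    apply Rle_trans with (1 := Cmod_triangle _ _).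
    generalize (Hl x _ Hx n) (Cmod_le_bnorm x n); simpl; lra. }
  exists (mkbseq l Hlb); intros eps.
  assert (Hd : 0 < eps / 4) by (generalize (cond_pos eps); lra).
  destruct (FC (mkposreal _ Hd)) as [x Hx].
  apply (filter_imp (F := F) (bball x (eps / 4))); [|exact Hx].
  intros y Hy.
  assert (Hxl : bdist (mkbseq l Hlb) x <= eps / 4 + eps / 4).
  { apply Rle_trans with (1 := bdist_sym _ _), bnorm_le; intros n; exact (Hl x _ Hx n). }
  unfold bball in *; generalize (bdist_triangle (mkbseq l Hlb) x y) (cond_pos eps); lra.
Qed.

(** Mutually finer filters have the same members, hence are equal by extensionality, and the choice
    operator returns the same limit. *)
Lemma blim_close (F1 F2 : (bseq -> Prop) -> Prop) :
  filter_le F1 F2 -> filter_le F2 F1 -> close (M := bseq_UniformSpace) (blim F1) (blim F2).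
Proof.
  intros H12 H21.
  replace F2 with F1; [exact (close_refl _)|].
  apply functional_extensionality; intros P; apply propositional_extensionality.
  split; [apply H21 | apply H12].
Qed.

Definition bseq_CompleteNormedModule : CompleteNormedModule C_AbsRing :=
  CompleteNormedModule.Pack C_AbsRing bseq
    (CompleteNormedModule.Class C_AbsRing bseq
       (NormedModule.Class _ _ _ bseq_NormedModule_mixin)
       (CompleteSpace.Mixin bseq_UniformSpace blim bseq_complete blim_close)) bseq.

(** The shift drops the first entry, so T^k x has value x_k at 0, and Psi(G; T) x at 0 is the
    pairing sum_k G_k x_k. *)
Definition bshift (x : bseq) : bseq.
Proof.
  exists (fun n => x (S n)).
  destruct (bval_bounded x) as [M HM]; exists M; intros n; apply HM.
Defined.

Lemma bshift_iter (x : bseq) (k n : nat) : Nat.iter k bshift x n = x (n + k)%nat.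
Proof.
  revert n; induction k as [|k IH]; intros n; simpl; [f_equal; lia|].
  rewrite IH; f_equal; lia.
Qed.

Lemma bshift_iter_norm (k : nat) (x : bseq) : bnorm (Nat.iter k bshift x) <= bnorm x.
Proof. apply bnorm_le; intros n; rewrite bshift_iter; apply Cmod_le_bnorm. Qed.

Lemma bshift_clinear : clinear (X := bseq_CompleteNormedModule) bshift.
Proof. split; intros; apply bseq_eq; reflexivity. Qed.

Definition bsign (g : L1) : bseq.
Proof.
  exists (fun n => RtoC (if Rle_dec 0 (g n) then 1 else -1)).
  exists 1; intros n; rewrite Cmod_R; destruct (Rle_dec 0 (g n)).
  - rewrite Rabs_R1; apply Rle_refl.
  - rewrite Rabs_left by lra; lra.
Defined.

Lemma bnorm_bsign (g : L1) : bnorm (bsign g) <= 1.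
Proof.
  apply bnorm_le; intros n; simpl; rewrite Cmod_R; destruct (Rle_dec 0 (g n)).
  - rewrite Rabs_R1; apply Rle_refl.
  - rewrite Rabs_left by lra; lra.
Qed.

Lemma bseq_is_series_eval (a : nat -> bseq) (l : bseq) (n : nat) :
  is_series (V := bseq_CompleteNormedModule) a l ->
  is_series (V := C_NormedModule) (fun k => a k n) (l n).
Proof.
  intros H.
  apply (is_series_of_bound (X := C_CompleteNormedModule)) with (2 := is_series_norm _ _ H).
  intros N.
  assert (E : forall N, sum_n (G := C_AbelianMonoid) (fun k => a k n) N
                        = (sum_n (G := bseq_AbelianMonoid) a N : bseq) n).
  { clear N; induction N as [|N IH]; [now rewrite !sum_O|].
    now rewrite !sum_Sn, IH. }
  change (Cmod (sum_n (G := C_AbelianMonoid) (fun k => a k n) N - l n) <=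
          bdist l (sum_n (G := bseq_AbelianMonoid) a N)).
  rewrite E.
  exact (Cmod_le_bnorm (badd (sum_n (G := bseq_AbelianMonoid) a N) (bopp l)) n).
Qed.

(* Testing the shift on the sign sequence of [g] recovers the full [L^1] norm. *)
Lemma nm_le_shift (g : L1) :
  nm g <= bnorm (wsum (X := bseq_CompleteNormedModule) g (fun k => Nat.iter k bshift (bsign g))).
Proof.
  apply Rle_trans with (2 := Cmod_le_bnorm _ 0%nat).
  assert (Hb : bounded_seq (X := bseq_CompleteNormedModule) (bnorm (bsign g))
                 (fun k => Nat.iter k bshift (bsign g)))
    by (intros k; exact (bshift_iter_norm k (bsign g))).
  assert (H := bseq_is_series_eval _ _ 0 (wsum_is_series g _ _ Hb)).
  assert (H' : is_series (V := C_NormedModule) (fun k => RtoC (Rabs (g k))) (RtoC (nm g)))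
    by (apply is_series_RtoC, Series_correct, coef_summable).
  assert (E : wsum (X := bseq_CompleteNormedModule) g (fun k => Nat.iter k bshift (bsign g)) 0%nat
              = RtoC (nm g)).
  { rewrite <- (series_lim_eq (V := C_CompleteNormedModule) _ _ H).
    apply (series_lim_eq (V := C_CompleteNormedModule)), is_series_ext with (2 := H').
    intros k; change (RtoC (Rabs (g k)) = Cmult (RtoC (g k)) (Nat.iter k bshift (bsign g) 0%nat)).
    rewrite bshift_iter; simpl bval; rewrite <- RtoC_mult; f_equal; simpl.
    destruct (Rle_dec 0 (g k)); [rewrite Rabs_pos_eq by lra | rewrite Rabs_left by lra]; ring. }
  rewrite E, Cmod_R; apply Rle_abs.
Qed.

Lemma ritt_Psi_shift (F : Z -> C) (f : L1) :
  (forall k, F (Z.of_nat k) = RtoC (f k)) ->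
  ritt (V := bseq_CompleteNormedModule) (fun _ => True) norm minus
    (Psi F (X := bseq_CompleteNormedModule) bshift) ->
  exists B, forall n, INR n * nm (mul (pw f n) (sub one1 f)) <= B.
Proof.
  intros HF [_ [M HM]].
  assert (Hit := iter_Psi (X := bseq_CompleteNormedModule) bshift F f 1 HF bshift_clinear
                   (fun n x => eq_ind_r (fun r => bnorm _ <= r) (bshift_iter_norm n x)
                                        (Rmult_1_l (bnorm x)))).
  exists (Rabs M); intros n; set (g := mul (pw f n) (sub one1 f)).
  assert (Hb : bounded_seq (X := bseq_CompleteNormedModule) (bnorm (bsign g))
                 (fun k => Nat.iter k bshift (bsign g)))
    by (intros k; exact (bshift_iter_norm k (bsign g))).
  assert (H := HM n (bsign g) I); rewrite !Hit in H.
  assert (E := wsum_sub (X := bseq_CompleteNormedModule) (pw f n) (pw f (S n)) _ _ Hb).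
  replace (sub (pw f n) (pw f (S n))) with g in E by (unfold g; simpl; ring).
  apply Rle_trans with (M * bnorm (bsign g)).
  - apply Rle_trans with (2 := H).
    apply Rmult_le_compat_l; [apply pos_INR|].
    apply Rle_trans with (1 := nm_le_shift g), Req_le.
    exact (f_equal bnorm E).
  - apply Rle_trans with (Rabs M * bnorm (bsign g)).
    + apply Rmult_le_compat_r; [|apply Rle_abs].
      apply Rle_trans with (2 := Cmod_le_bnorm _ 0%nat), Cmod_ge_0.
    + rewrite <- (Rmult_1_r (Rabs M)) at 2.
      apply Rmult_le_compat_l; [apply Rabs_pos | apply bnorm_bsign].
Qed.

(** * The generating function and the sector condition *)

Section Generating.

Variable w : C.
Hypothesis w_le1 : Cmod w <= 1.

Let u (k : nat) : C := @pow_n C_Ring w k.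
Let phi (f : L1) : C := wsum (X := C_CompleteNormedModule) f u.

Lemma Cmod_pow_n_le1 (k : nat) : Cmod (u k) <= 1.
Proof.
  induction k as [|k IH]; [apply Req_le, Cmod_1|].
  change (Cmod (w * u k) <= 1); rewrite Cmod_mult, <- (Rmult_1_l 1).
  apply Rmult_le_compat; auto using Cmod_ge_0.
Qed.

Lemma powers_bounded : bounded_seq (X := C_CompleteNormedModule) 1 u.
Proof. exact Cmod_pow_n_le1. Qed.

Lemma phiF_emb (f : L1) : phiF (emb f) w = phi f.
Proof.
  unfold phiF, phi, wsum; f_equal; apply functional_extensionality; intros k.
  now rewrite emb_nat.
Qed.

Lemma Cmod_phi (f : L1) : Cmod (phi f) <= nm f.
Proof. rewrite <- (Rmult_1_l (nm f)); exact (norm_wsum f u 1 powers_bounded). Qed.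

Lemma phi_one : phi one1 = RtoC 1.
Proof. exact (wsum_one (X := C_CompleteNormedModule) u). Qed.

Lemma phi_sub (f g : L1) : phi (sub f g) = Cminus (phi f) (phi g).
Proof. exact (wsum_sub f g u 1 powers_bounded). Qed.

(** Along the orbit w^k the shift by [k] is multiplication by w^k, so the inner sums of [wsum_mul]
    factor. *)
Lemma phi_mul (f g : L1) : phi (mul f g) = Cmult (phi f) (phi g).
Proof.
  apply eq_trans with (1 := eq_sym
    (series_lim_eq (V := C_CompleteNormedModule) _ _ (wsum_mul f g u 1 powers_bounded))).
  apply (series_lim_eq (V := C_CompleteNormedModule)).
  rewrite Cmult_comm.
  apply is_series_ext with
    (2 := is_series_scal (V := C_NormedModule) (phi g) _ _ (wsum_is_series f u 1 powers_bounded)).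
  intros k.
  assert (E : wsum (X := C_CompleteNormedModule) g (fun j => u (k + j)%nat) = Cmult (u k) (phi g)).
  { unfold phi.
    rewrite (wsum_map (X := C_CompleteNormedModule) (Cmult (u k)) (Cmod (u k)) 1 g u).
    - apply wsum_ext; intros j; exact (pow_n_plus (K := C_Ring) w k j).
    - split; intros.
      + apply Cmult_plus_distr_l.
      + change (u k * (c * x) = c * (u k * x))%C; ring.
    - intros x; apply Req_le; exact (Cmod_mult (u k) x).
    - exact powers_bounded. }
  rewrite E; change (phi g * (RtoC (f k) * u k) = RtoC (f k) * (u k * phi g))%C; ring.
Qed.

Lemma Cmod_phi_pw (f : L1) (n : nat) : Cmod (phi (pw f n)) = Cmod (phi f) ^ n.
Proof.
  induction n as [|n IH]; simpl; [now rewrite phi_one, Cmod_1|].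
  now rewrite phi_mul, Cmod_mult, IH.
Qed.

Lemma phi_ritt (f : L1) (B : R) :
  (forall n, INR n * nm (mul (pw f n) (sub one1 f)) <= B) ->
  forall n, INR n * (Cmod (phi f) ^ n * Cmod (1 - phi f)) <= B.
Proof.
  intros HB n; apply Rle_trans with (2 := HB n), Rmult_le_compat_l; [apply pos_INR|].
  rewrite <- Cmod_phi_pw, <- phi_one, <- phi_sub, <- Cmod_mult, <- phi_mul.
  apply Cmod_phi.
Qed.

End Generating.

Lemma bernoulli (d : R) (n : nat) : 0 <= d <= 1 -> 1 - INR n * d <= (1 - d) ^ n.
Proof.
  intros Hd; induction n as [|n IH]; [simpl; lra|].
  rewrite S_INR; simpl pow.
  apply Rle_trans with ((1 - d) * (1 - INR n * d)).
  - generalize (pos_INR n); intros; nra.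
  - apply Rmult_le_compat_l; lra.
Qed.

(* The hypothesis is used at [n] close to [1 / (2 (1 - |z|))], where [|z| ^ n >= 1 / 2]. *)
Lemma stolz_of_ritt (z : C) (B : R) :
  Cmod z <= 1 -> (forall n, INR n * (Cmod z ^ n * Cmod (1 - z)) <= B) ->
  Cmod (1 - z) <= (8 * B + 8) * (1 - Cmod z).
Proof.
  intros Hz HB.
  assert (HB0 : 0 <= B) by (generalize (HB 0%nat); simpl; lra).
  assert (Hm := Cmod_ge_0 z); assert (Hu := Cmod_ge_0 (1 - z)).
  assert (Hu2 : Cmod (1 - z) <= 2).
  { apply Rle_trans with (1 := Cmod_triangle _ _); rewrite Cmod_opp, Cmod_1; lra. }
  set (U := Cmod (1 - z)) in *; set (d := 1 - Cmod z).
  replace (Cmod z) with (1 - d) in HB by (unfold d; ring).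
  assert (Hd : 0 <= d <= 1) by (unfold d; lra).
  clearbody U d; clear z Hz Hm.
  destruct (Rle_lt_or_eq_dec 0 d (proj1 Hd)) as [Hpos|E].
  (* For d > 1/4 the claim follows from |1 - z| <= 2 <= 8d. Otherwise n + 1 > 1 / (2d) still leaves
     n d >= 1/2 - d >= 1/4. *)
  - destruct (Rle_dec d (1 / 4)) as [Hsmall|Hbig]; [|nra].
    destruct (nfloor_ex (/ (2 * d))) as [n [Hn1 Hn2]]; [left; apply Rinv_0_lt_compat; lra|].
    assert (Hnd : INR n * d <= 1 / 2).
    { apply Rmult_le_compat_r with (r := d) in Hn1; [|lra].
      replace (/ (2 * d) * d) with (1 / 2) in Hn1 by (field; lra); exact Hn1. }
    assert (Hnd2 : 1 / 4 <= INR n * d).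
    { apply Rmult_lt_compat_r with (r := d) in Hn2; [|lra].
      replace (/ (2 * d) * d) with (1 / 2) in Hn2 by (field; lra); lra. }
    assert (Hb := bernoulli d n Hd).
    assert (H1 : INR n * (1 / 2 * U) <= B).
    { apply Rle_trans with (2 := HB n), Rmult_le_compat_l; [apply pos_INR|].
      apply Rmult_le_compat_r; lra. }
    (* U / 4 <= d (n U) <= 2 B d, which is where 8B comes from. *)
    assert (H2 : (1 / 4) * U <= (INR n * d) * U) by (apply Rmult_le_compat_r; lra).
    assert (H3 : d * (INR n * (1 / 2 * U)) <= d * B) by (apply Rmult_le_compat_l; lra).
    nra.
  (* On the unit circle the hypothesis reads n U <= B for all n, which forces U = 0. *)
  - subst d; rewrite Rmult_0_r; apply Rnot_lt_le; intros HU.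
    destruct (nfloor_ex (B / U)) as [n [_ Hn]].
    { apply Rmult_le_pos; [lra | left; now apply Rinv_0_lt_compat]. }
    assert (H := HB (S n)); rewrite Rminus_0_r, pow1, Rmult_1_l, S_INR in H.
    apply Rmult_lt_compat_r with (r := U) in Hn; [|exact HU].
    unfold Rdiv in Hn; rewrite Rmult_assoc, Rinv_l in Hn by lra; lra.
Qed.

Lemma in_D_or_1_of_stolz (z : C) (K : R) :
  Cmod z <= 1 -> Cmod (1 - z) <= K * (1 - Cmod z) -> in_D_or_1 z.
Proof.
  intros Hz HK; destruct (Rle_lt_or_eq_dec _ _ Hz) as [H|E]; [now left | right].
  rewrite E, Rminus_diag, Rmult_0_r in HK.
  assert (E0 : (1 - z)%C = 0) by (apply Cmod_eq_0, Rle_antisym; [exact HK | apply Cmod_ge_0]).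
  replace z with (1 - (1 - z))%C by ring; rewrite E0; ring.
Qed.

(** For v = 1 - z one has |Im v| <= |v| <= K Re v, so the tangent of the argument is at most K in
    absolute value. If Re v = 0, then 1 - |z| <= 0 and v vanishes. *)
Lemma sector_of_stolz (z : C) (K : R) :
  0 < K -> Cmod z <= 1 -> Cmod (1 - z) <= K * (1 - Cmod z) -> in_sector (atan K) (1 - z)%C.
Proof.
  intros HK Hz H.
  assert (Hre : 1 - Cmod z <= Re (1 - z)%C).
  { replace (Re (1 - z)%C) with (1 - Re z) by (destruct z; simpl; ring).
    generalize (re_le_Cmod z) (Rle_abs (Re z)); lra. }
  assert (Him : Rabs (Im (1 - z)%C) <= K * Re (1 - z)%C).
  { apply Rle_trans with (Cmod (1 - z)).
    - set (v := (1 - z)%C); unfold Cmod; rewrite <- sqrt_Rsqr_abs; apply sqrt_le_1_alt.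
      unfold Rsqr; destruct v as [a b]; simpl; nra.
    - apply Rle_trans with (1 := H), Rmult_le_compat_l; lra. }
  set (v := (1 - z)%C) in *.
  destruct (Rle_lt_or_eq_dec 0 (Re v)) as [Hpos|E]; [lra | |].
  - right; destruct v as [a b]; simpl in *.
    exists (atan (b / a)).
    destruct (atan_bound (b / a)) as [Ha1 Ha2].
    assert (HPI := PI_RGT_0).
    split; [lra|]; split.
    + assert (Hmono : forall x, x <= K -> atan x <= atan K).
      { intros x [Hx| ->]; [left; now apply atan_increasing | apply Rle_refl]. }
      assert (Hba : Rabs b / a <= K).
      { apply Rmult_le_reg_r with (1 := Hpos); unfold Rdiv; rewrite Rmult_assoc, Rinv_l by lra; lra. }
      unfold Rabs in Hba; unfold Rabs; destruct (Rcase_abs (atan (b / a))).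
      * rewrite <- atan_opp; apply Hmono.
        apply Rle_trans with (2 := Hba); destruct (Rcase_abs b); [right; field; lra|].
        unfold Rdiv; assert (0 < / a) by now apply Rinv_0_lt_compat.
        nra.
      * apply Hmono; apply Rle_trans with (2 := Hba); destruct (Rcase_abs b); [|lra].
        unfold Rdiv; assert (0 < / a) by now apply Rinv_0_lt_compat.
        nra.
    + assert (Hs : 0 < 1 + Rsqr (b / a)) by (generalize (Rle_0_sqr (b / a)); lra).
      assert (Hsq := sqrt_lt_R0 _ Hs).
      assert (Hmod : Cmod (a, b) = a * sqrt (1 + Rsqr (b / a))).
      { rewrite <- (sqrt_Rsqr a) at 2 by lra.
        rewrite <- sqrt_mult by (try lra; apply Rle_0_sqr).
        unfold Cmod; f_equal; unfold Rsqr; simpl; field; lra. }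
      rewrite cos_atan, sin_atan, Hmod.
      unfold Cmult, RtoC; simpl; f_equal; field; lra.
  - left; rewrite <- E in Hre; apply Cmod_eq_0, Rle_antisym; [|apply Cmod_ge_0].
    apply Rle_trans with (1 := H); nra.
Qed.

Lemma phi_stolz (f : L1) : nm f <= 1 ->
  (exists B, forall n, INR n * nm (mul (pw f n) (sub one1 f)) <= B) ->
  exists K, 0 < K /\ forall w, Cmod w <= 1 -> Cmod (phiF (emb f) w) <= 1 /\
    Cmod (1 - phiF (emb f) w) <= K * (1 - Cmod (phiF (emb f) w)).
Proof.
  intros Hf [B HB]; exists (8 * B + 8).
  assert (HB0 : 0 <= B) by (generalize (HB 0%nat); simpl; lra).
  split; [lra|]; intros w Hw.
  rewrite phiF_emb by exact Hw.
  assert (H1 := Rle_trans _ _ _ (Cmod_phi w Hw f) Hf).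
  split; [exact H1|]; apply stolz_of_ritt; [exact H1|].
  now apply phi_ritt.
Qed.

(** * Fourier transform on the circle *)

Lemma Cmod_cos_sin (x : R) : Cmod (cos x, sin x) = 1.
Proof.
  unfold Cmod; transitivity (sqrt 1); [|exact sqrt_1].
  f_equal; simpl; generalize (sin2_cos2 x); unfold Rsqr; lra.
Qed.

Lemma pow_n_cos_sin (x : R) (k : nat) :
  @pow_n C_Ring (cos x, sin x) k = (cos (INR k * x), sin (INR k * x)).
Proof.
  induction k as [|k IH]; [simpl; now rewrite Rmult_0_l, cos_0, sin_0|].
  change (Cmult (cos x, sin x) (@pow_n C_Ring (cos x, sin x) k)
          = (cos (INR (S k) * x), sin (INR (S k) * x))).
  rewrite IH, S_INR, Rmult_plus_distr_r, Rmult_1_l, cos_plus, sin_plus.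
  unfold Cmult; simpl; f_equal; ring.
Qed.

Lemma Fhat_phiF (f : L1) (xi : R) : Fhat (emb f) xi = phiF (emb f) (cos (- xi), sin (- xi)).
Proof.
  unfold Fhat, phiF, zsum.
  rewrite (series_lim_eq (V := C_CompleteNormedModule)
             (fun n => Cmult (emb f (neg_idx n)) (cos (IZR (neg_idx n) * xi), - sin (IZR (neg_idx n) * xi)))
             (RtoC 0)).
  - rewrite Cplus_0_r; f_equal; apply functional_extensionality; intros k; f_equal.
    rewrite pow_n_cos_sin, <- INR_IZR_INZ, Ropp_mult_distr_r_reverse, cos_neg, sin_neg.
    reflexivity.
  - apply is_series_ext with (2 := is_series_C_zero).
    intros k; rewrite emb_neg by apply neg_idx_neg; symmetry; apply Cmult_0_l.
Qed.

Lemma trig_summable (f : L1) (t : R -> R) (x : R) :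
  (forall y, Rabs (t y) <= 1) -> ex_series (fun k => f k * t (INR k * x)).
Proof.
  intros Ht; apply @ex_series_le with (2 := coef_summable f).
  intros k; unfold norm; simpl; unfold abs; simpl; rewrite Rabs_mult.
  rewrite <- (Rmult_1_r (Rabs (f k))) at 2.
  apply Rmult_le_compat_l; [apply Rabs_pos | apply Ht].
Qed.

Lemma Rabs_cos_le1 (y : R) : Rabs (cos y) <= 1.
Proof. apply Rabs_le; generalize (COS_bound y); lra. Qed.

Lemma Rabs_sin_le1 (y : R) : Rabs (sin y) <= 1.
Proof. apply Rabs_le; generalize (SIN_bound y); lra. Qed.

Lemma phiF_circle (f : L1) (x : R) :
  phiF (emb f) (cos x, sin x)
  = (Series (fun k => f k * cos (INR k * x)), Series (fun k => f k * sin (INR k * x))).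
Proof.
  apply (series_lim_eq (V := C_CompleteNormedModule)).
  apply is_series_ext with (2 := is_series_pair _ _ _ _
    (Series_correct _ (trig_summable f cos x Rabs_cos_le1))
    (Series_correct _ (trig_summable f sin x Rabs_sin_le1))).
  intros k; rewrite emb_nat, pow_n_cos_sin.
  unfold Cmult, RtoC; simpl; f_equal; ring.
Qed.

(** If all atoms have the same phase at [xi], the transform equals that phase, which is unimodular
    and must therefore be 1. The sign in [Fhat] makes - xi the point to test. *)
Lemma Fhat_aperiodic (f : L1) : nonneg_seq f -> nm f = 1 ->
  (forall xi, - PI <= xi <= PI -> in_D_or_1 (Fhat (emb f) xi)) ->
  forall xi t, - PI <= xi <= PI -> 0 < f t ->
     (forall n, 0 < f n -> cos (INR n * xi) = cos (INR t * xi) /\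
                           sin (INR n * xi) = sin (INR t * xi)) ->
     cos (INR t * xi) = 1.
Proof.
  intros Hf Hm HD xi t Hxi Ht Hall.
  assert (HD' := HD (- xi) ltac:(lra)).
  rewrite Fhat_phiF, Ropp_involutive, phiF_circle in HD'.
  assert (E : forall s : R -> R, (forall n, 0 < f n -> s (INR n * xi) = s (INR t * xi)) ->
            Series (fun k => f k * s (INR k * xi)) = s (INR t * xi)).
  { intros s Hs; transitivity (Series (fun k => f k * s (INR t * xi))).
    - apply Series_ext; intros k.
      destruct (Rle_lt_or_eq_dec _ _ (Hf k)) as [Hp|E0]; [now rewrite Hs | rewrite <- E0; ring].
    - rewrite Series_scal_r, <- (nm_nonneg f Hf), Hm; ring. }
  rewrite (E cos), (E sin) in HD' by (intros n Hn; now apply Hall).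
  destruct HD' as [Hlt|E1]; [rewrite Cmod_cos_sin in Hlt; lra|].
  exact (f_equal fst E1).
Qed.

(** * Infinite mean *)

(** From 1 - cos x = 2 sin^2 (x / 2). The quadratic bound is for finitely many terms as the
    frequency tends to 0, the linear one dominates the tail by the mean. *)
Lemma one_minus_cos_bounds (x : R) : 0 <= x -> 1 - cos x <= x * x /\ 1 - cos x <= x.
Proof.
  intros Hx.
  assert (E : 1 - cos x = 2 * (sin (x / 2) * sin (x / 2))).
  { replace (cos x) with (cos (2 * (x / 2))) by (f_equal; field).
    rewrite cos_2a_sin; ring. }
  assert (H1 : Rabs (sin (x / 2)) <= x / 2).
  { destruct (Req_dec x 0) as [->|Hne].
    - replace (0 / 2) with 0 by field; rewrite sin_0, Rabs_R0; lra.
    - apply Rabs_le; split.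
      + destruct (Rle_dec (x / 2) PI).
        * generalize (sin_ge_0 (x / 2) ltac:(lra) ltac:(lra)); lra.
        * generalize (SIN_bound (x / 2)) PI2_1; lra.
      + left; apply sin_lt_x; lra. }
  assert (H2 := Rabs_sin_le1 (x / 2)).
  assert (E2 : sin (x / 2) * sin (x / 2) = Rabs (sin (x / 2)) * Rabs (sin (x / 2))).
  { rewrite <- Rabs_mult; symmetry; apply Rabs_pos_eq, Rle_0_sqr. }
  rewrite E, E2; set (s := Rabs (sin (x / 2))) in *.
  assert (0 <= s) by apply Rabs_pos.
  split; nra.
Qed.

Lemma x_minus_sin_bounds (x : R) : 0 <= x -> x - sin x <= x * x /\ x - sin x <= 2 * x.
Proof.
  intros [Hx| <-]; [|rewrite sin_0; lra].
  assert (Hq : x - sin x <= x * x).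
  { destruct (MVT_cor2 (fun y => y * y - y + sin y) (fun y => 2 * y - 1 + cos y) 0 x Hx)
      as [c [Hc [Hc0 _]]].
    - intros c _; apply is_derive_Reals; auto_derive; [trivial | ring].
    - rewrite sin_0 in Hc.
      assert (H := proj2 (one_minus_cos_bounds c ltac:(lra))).
      assert (0 <= (2 * c - 1 + cos c) * (x - 0)) by (apply Rmult_le_pos; lra).
      lra. }
  split; [exact Hq|].
  destruct (Rle_dec x 1); [nra|].
  generalize (SIN_bound x); lra.
Qed.

(** For the cosine and sine sums c and s at xi, the hypothesis gives s <= K (1 - c), that is mu xi
    <= sum_k f_k h(k xi). As h(x) is both O(x^2) and O(x), a finite mean makes the right side
    o(xi). *)
Lemma mean_zero_of_stolz (f : L1) (K : R) :
  0 < K -> nonneg_seq f -> nm f = 1 ->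
  (forall w, Cmod w <= 1 -> Cmod (1 - phiF (emb f) w) <= K * (1 - Cmod (phiF (emb f) w))) ->
  ex_series (fun k => INR k * f k) -> Series (fun k => INR k * f k) <= 0.
Proof.
  intros HK Hf Hm Hst Hex.
  set (m k := INR k * f k) in *.
  assert (Hm0 : forall k, 0 <= m k) by (intros k; apply Rmult_le_pos; [apply pos_INR | apply Hf]).
  set (mu := Series m).
  set (h x := K * (1 - cos x) + (x - sin x)).
  assert (Hh0 : forall x, 0 <= x -> 0 <= h x).
  { intros x [Hx| <-].
    - unfold h; generalize (COS_bound x) (sin_lt_x x Hx); intros; nra.
    - unfold h; rewrite cos_0, sin_0; lra. }
  assert (Hh1 : forall x, 0 <= x -> h x <= (K + 1) * (x * x) /\ h x <= (K + 2) * x).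
  { intros x Hx; destruct (one_minus_cos_bounds x Hx), (x_minus_sin_bounds x Hx).
    unfold h; split; nra. }
  assert (Hfh : forall xi, 0 < xi -> forall k, 0 <= f k * h (INR k * xi) <= (K + 2) * xi * m k).
  { intros xi Hxi k.
    assert (Hk : 0 <= INR k * xi) by (apply Rmult_le_pos; [apply pos_INR | lra]).
    split; [apply Rmult_le_pos; [apply Hf | now apply Hh0]|].
    unfold m; replace ((K + 2) * xi * (INR k * f k)) with (f k * ((K + 2) * (INR k * xi))) by ring.
    apply Rmult_le_compat_l; [apply Hf | now apply Hh1]. }
  assert (Hscal : forall c, ex_series (fun k => c * m k))
    by (intros c; now apply @ex_series_scal with (V := R_NormedModule)).
  assert (Hexh : forall xi, 0 < xi -> ex_series (fun k => f k * h (INR k * xi))).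
  { intros xi Hxi; apply @ex_series_le with (2 := Hscal ((K + 2) * xi)).
    intros k; unfold norm; simpl; unfold abs; simpl.
    rewrite Rabs_pos_eq by now apply Hfh. now apply Hfh. }
  assert (Hmass : Series f = 1) by now rewrite <- nm_nonneg.
  assert (Hmain : forall xi, 0 < xi -> mu * xi <= Series (fun k => f k * h (INR k * xi))).
  { intros xi Hxi.
    assert (Hs := Hst (cos xi, sin xi) (Req_le _ _ (Cmod_cos_sin xi))).
    rewrite phiF_circle in Hs.
    set (c := Series (fun k => f k * cos (INR k * xi))) in *.
    set (s := Series (fun k => f k * sin (INR k * xi))) in *.
    assert (Hsc : s <= K * (1 - c)).
    { assert (H1 : s <= Cmod (1 - (c, s))).
      { apply Rle_trans with (1 := Rle_abs s); unfold Cmod.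
        rewrite <- sqrt_Rsqr_abs; apply sqrt_le_1_alt; simpl.
        generalize (Rle_0_sqr (1 - c)); unfold Rsqr; lra. }
      assert (H2 : c <= Cmod (c, s)).
      { apply Rle_trans with (1 := Rle_abs c), (re_le_Cmod (c, s)). }
      assert (K * (1 - Cmod (c, s)) <= K * (1 - c)) by (apply Rmult_le_compat_l; lra).
      lra. }
    assert (E : Series (fun k => f k * h (INR k * xi)) = K * (1 - c) + (mu * xi - s)).
    { unfold h, mu.
      rewrite (Series_ext _ (fun k => (K * (f k - f k * cos (INR k * xi)))
                 + (m k * xi - f k * sin (INR k * xi)))) by (intros k; unfold m; ring).
      assert (E1 : ex_series (fun k => f k - f k * cos (INR k * xi))).
      { apply (ex_series_minus (V := R_NormedModule)); [apply nonneg_ex_series|].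
        apply (trig_summable f cos), Rabs_cos_le1. }
      assert (E2 : ex_series (fun k => m k * xi)).
      { apply ex_series_ext with (2 := Hscal xi); intros k; apply Rmult_comm. }
      rewrite Series_plus.
      - rewrite Series_scal_l, Series_minus, Series_minus, Series_scal_r, Hmass; auto.
        + apply (trig_summable f sin), Rabs_sin_le1.
        + apply nonneg_ex_series.
        + apply (trig_summable f cos), Rabs_cos_le1.
      - now apply @ex_series_scal with (V := R_NormedModule).
      - apply (ex_series_minus (V := R_NormedModule)); [exact E2|].
        apply (trig_summable f sin), Rabs_sin_le1. }
    rewrite E; lra. }
  (* Dominated convergence by hand: the terms up to [N] are O(xi^2), the others at most (K + 2) xi
     times the tail of the mean. Dividing by xi and letting xi tend to 0 leaves the tail. *)
  assert (Htail : forall N, mu <= (K + 2) * (mu - sum_n m N)).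
  { intros N.
    set (P := sum_n (fun k => (K + 1) * (INR k * INR k) * f k) N).
    assert (Hbound : forall xi, 0 < xi -> mu <= P * xi + (K + 2) * (mu - sum_n m N)).
    { intros xi Hxi; apply Rmult_le_reg_r with (1 := Hxi).
      apply Rle_trans with (1 := Hmain xi Hxi).
      assert (Et := Series_tail _ N (Hexh xi Hxi)).
      assert (Et' := Series_tail _ N (Hscal ((K + 2) * xi))).
      assert (H1 : sum_n (fun k => f k * h (INR k * xi)) N <= P * xi * xi).
      { unfold P; rewrite !sum_n_Reals.
        replace (sum_f_R0 (fun k => (K + 1) * (INR k * INR k) * f k) N * xi * xi)
          with (sum_f_R0 (fun k => ((K + 1) * (INR k * INR k) * f k) * (xi * xi)) N)
          by (rewrite <- scal_sum; ring).
        apply sum_Rle; intros k _.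
        replace ((K + 1) * (INR k * INR k) * f k * (xi * xi))
          with (f k * ((K + 1) * ((INR k * xi) * (INR k * xi)))) by ring.
        apply Rmult_le_compat_l; [apply Hf|].
        apply Hh1, Rmult_le_pos; [apply pos_INR | lra]. }
      assert (H2 : Series (fun k => f (S N + k)%nat * h (INR (S N + k) * xi))
                   <= Series (fun k => (K + 2) * xi * m (S N + k)%nat)).
      { apply Series_le; [intros k; now apply Hfh|].
        exact (proj1 (ex_series_incr_n (fun k => (K + 2) * xi * m k) (S N)) (Hscal _)). }
      rewrite Et' in H2; rewrite Et in H2.
      rewrite Series_scal_l in H2; fold mu in H2.
      rewrite sum_n_scal_R in H2; lra. }
    apply Rnot_lt_le; intros Hlt.
    set (g := mu - (K + 2) * (mu - sum_n m N)).
    assert (Hg : 0 < g) by (unfold g; lra).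
    assert (HP : 0 <= P).
    { apply sum_n_nonneg; intros k; apply Rmult_le_pos; [|apply Hf].
      generalize (pos_INR k); intros; apply Rmult_le_pos; nra. }
    (* This xi makes P xi at most half of the gap [g], a contradiction; P + 1 avoids division by
       zero. *)
    assert (Hxi : 0 < g / (2 * (P + 1))) by (apply Rdiv_lt_0_compat; lra).
    assert (H := Hbound _ Hxi).
    assert (P * (g / (2 * (P + 1))) <= g / 2).
    { apply Rle_trans with ((P + 1) * (g / (2 * (P + 1)))).
      - apply Rmult_le_compat_r; lra.
      - right; field; lra. }
    unfold g in *; lra. }
  assert (Hl := is_lim_seq_le (fun _ => mu) (fun N => (K + 2) * (mu - sum_n m N)) mu
                  ((K + 2) * (mu - mu)) Htail (is_lim_seq_const mu)).
  rewrite Rminus_diag, Rmult_0_r in Hl; apply Hl.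
  replace (Finite 0) with (Rbar_mult (K + 2) (Finite (mu - mu)))
    by (simpl; f_equal; ring).
  apply is_lim_seq_scal_l, is_lim_seq_minus'; [apply is_lim_seq_const|].
  now apply sum_n_to_Series.
Qed.

Lemma mean_zero_one (f : L1) : nonneg_seq f -> nm f = 1 ->
  ex_series (fun k => INR k * f k) -> Series (fun k => INR k * f k) <= 0 -> f = one1.
Proof.
  intros Hf Hm Hex Hle.
  assert (H0 : forall k, INR k * f k <= 0).
  { intros k; apply Rle_trans with (2 := Hle).
    apply (term_le_Series (fun k => INR k * f k)); [|exact Hex].
    intros n; apply Rmult_le_pos; [apply pos_INR | apply Hf]. }
  assert (HS : forall k, f (S k) = 0).
  { intros k; apply Rle_antisym; [|apply Hf].
    apply Rmult_le_reg_l with (INR (S k)); [apply lt_0_INR; lia|].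
    rewrite Rmult_0_r; apply H0. }
  assert (E : f = scl (f 0%nat) one1).
  { apply L1_eq; intros [|k]; simpl; [ring | rewrite HS; ring]. }
  rewrite E, nm_scl, nm_one, Rabs_pos_eq in Hm by apply Hf.
  replace (f 0%nat) with 1 in E by lra.
  rewrite E; apply L1_eq; intros n; simpl; ring.
Qed.

Lemma nonneg_series_dichotomy (a : nat -> R) :
  (forall n, 0 <= a n) -> ex_series a \/ is_lim_seq (sum_n a) p_infty.
Proof.
  intros Ha; destruct (classic (exists B, forall N, sum_n a N <= B)) as [[B HB]|Hno].
  - left; now apply (ex_series_bounded a B).
  - right; apply is_lim_seq_spec; intros B.
    destruct (not_all_ex_not _ _ (fun H => Hno (ex_intro _ B H))) as [N HN].
    exists N; intros n Hn; apply Rlt_le_trans with (1 := Rnot_le_lt _ _ HN).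
    induction Hn as [|n Hn IH]; [apply Rle_refl|].
    apply Rle_trans with (1 := IH); rewrite sum_Sn; unfold plus; simpl.
    generalize (Ha (S n)); lra.
Qed.

Lemma infinite_support (F : Z -> C) :
  is_lim_seq (sum_n (fun k => INR k * Re (F (Z.of_nat k)))) p_infty ->
  forall N, exists k, (N <= k)%Z /\ F k <> RtoC 0.
Proof.
  intros H N; apply NNPP; intros Hno.
  assert (HF : forall k, (N <= k)%Z -> F k = RtoC 0).
  { intros k Hk; apply NNPP; intros Hne; apply Hno; now exists k. }
  set (a k := INR k * Re (F (Z.of_nat k))) in *.
  assert (Ha : is_series a (sum_n a (Z.to_nat N))).
  { apply is_series_finite; intros k Hk; unfold a.
    rewrite HF by lia; simpl; ring. }
  assert (E := is_lim_seq_unique _ _ H).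
  assert (E' : Lim_seq (sum_n a) = sum_n a (Z.to_nat N)) by (apply is_lim_seq_unique; exact Ha).
  rewrite E' in E; discriminate.
Qed.

Theorem theorem4p1 (F : Z -> C) (HF : PZplus F) :
  let condI := classA F in
  let condII := ritt summable l1norm lsub (conv F) in
  let condIII :=
    forall (X : CompleteNormedModule C_AbsRing) (T : X -> X),
      clinear T -> power_bounded (fun _ => True) norm T ->
      ritt (fun _ => True) norm minus (Psi F T) in
  let condIV :=
    (forall xi : R, - PI <= xi <= PI -> in_D_or_1 (Fhat F xi)) /\
    (exists M : R, forall t : R, 1 <= t ->
       t * l1norm (conv (lsub delta0 F)
                        (lexp (lscal (RtoC (- t)) (lsub delta0 F)))) <= M) in
  (condI <-> condII) /\ (condI <-> condIII) /\ (condI <-> condIV) /\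
  (condI ->
     exists theta : R, 0 < theta < PI / 2 /\
       forall w : C, Cmod w <= 1 ->
         in_D_or_1 (phiF F w) /\ in_sector theta (Cminus (RtoC 1) (phiF F w))) /\
  (condI -> F <> delta0 ->
     is_lim_seq (sum_n (fun k : nat => INR k * Re (F (Z.of_nat k)))) p_infty /\
     (forall N : Z, exists k : Z, (N <= k)%Z /\ F k <> RtoC 0)).
Proof.
  intros condI condII condIII condIV.
  destruct (PZplus_emb F HF) as (f & EF & Hf & Hm).
  assert (Hm1 : nm f <= 1) by lra.
  assert (HFf : forall k, F (Z.of_nat k) = RtoC (f k)) by (intros k; rewrite EF; apply emb_nat).
  (* All the other conditions are compared with this form of (I), which lives entirely in the real
     algebra. *)
  assert (HI : condI <-> exists B, forall n, INR n * nm (mul (pw f n) (sub one1 f)) <= B).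
  { unfold condI; rewrite EF; apply classA_emb; now rewrite <- EF. }
  split; [|split; [|split; [|split]]].
  - split; [|now apply ritt_conv_classA].
    intros H; unfold condII; rewrite EF; apply ritt_conv; [exact Hm1 | now apply HI].
  - split.
    + intros H X T; apply ritt_Psi with f; auto; now apply HI.
    + intros H; apply HI, (ritt_Psi_shift F f HFf).
      apply (H bseq_CompleteNormedModule bshift bshift_clinear).
      exists 1; intros n x _; rewrite Rmult_1_l; exact (bshift_iter_norm n x).
  - split.
    + intros H; apply HI in H; split.
      * intros xi _; rewrite EF, Fhat_phiF.
        destruct (phi_stolz f Hm1 H) as (K & _ & HK).
        destruct (HK _ (Req_le _ _ (Cmod_cos_sin (- xi)))) as [H1 H2].
        now apply in_D_or_1_of_stolz with K.
      * destruct H as [M HM]; exists (2 * M + 2); intros t Ht.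
        rewrite EF, l1norm_heat; apply ritt_heat; [exact Hm1 | exact HM | lra].
    + intros [HD [M HM]]; apply HI.
      apply (heat_ritt f Hm1 M).
      * intros t Ht; rewrite <- l1norm_heat, <- EF; now apply HM.
      * apply aperiodic_gap_to_0; auto.
        apply Fhat_aperiodic; auto; now rewrite <- EF.
  - intros H; apply HI in H.
    destruct (phi_stolz f Hm1 H) as (K & HK0 & HK).
    exists (atan K); split.
    + split; [|apply atan_bound].
      rewrite <- atan_0; now apply atan_increasing.
    + intros w Hw; rewrite EF; destruct (HK w Hw) as [H1 H2].
      split; [now apply in_D_or_1_of_stolz with K | now apply sector_of_stolz].
  - intros H HFd; apply HI in H.
    assert (Hinf : is_lim_seq (sum_n (fun k => INR k * Re (F (Z.of_nat k)))) p_infty).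
    { apply is_lim_seq_ext with (sum_n (fun k => INR k * f k)).
      - intros n; apply sum_n_ext; intros k; now rewrite HFf.
      - destruct (nonneg_series_dichotomy (fun k => INR k * f k)) as [Hex|Hinf]; [| |exact Hinf].
        + intros k; apply Rmult_le_pos; [apply pos_INR | apply Hf].
        + exfalso; apply HFd.
          destruct (phi_stolz f Hm1 H) as (K & HK0 & HK).
          rewrite EF, delta0_emb; f_equal; f_equal.
          apply mean_zero_one; auto.
          apply mean_zero_of_stolz with K; auto; intros w Hw; now apply HK. }
    split; [exact Hinf | now apply infinite_support].
Qed.
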